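(* Let $\beta=0$ or $\beta\ge1$. For each $n$ let $(X^n_t)_{t\ge0}$ be the Dyson--Ornstein--Uhlenbeck (DOU) process with parameter $\beta$ and initial condition $x_0^n$, with invariant law $P_n^\beta$. Let $\mathrm{dist}\in\{\mathrm{TV},\mathrm{Hellinger},\mathrm{Kullback},\chi^2,\mathrm{Wasserstein}\}$. Set $\pi(x)=x_1+\cdots+x_n$ and \[ c_n:=\begin{cases}\log(|\pi(x_0^n)|)&\text{if }\mathrm{dist}\in\{\mathrm{TV},\mathrm{Hellinger},\mathrm{Kullback},\chi^2\}\\ \log\Bigl(\frac{|\pi(x_0^n)|}{\sqrt n}\Bigr)&\text{if }\mathrm{dist}=\mathrm{Wasserstein},\end{cases} \] and assume that $\lim_{n\to\infty}c_n=\infty$. Then, for all $\varepsilon\in(0,1)$, \[ \lim_{n\to\infty}\mathrm{dist}(\mathrm{Law}(X^n_{(1-\varepsilon)c_n})\mid P_n^\beta)=\max . \]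
   Context: The DOU process with parameter $\beta$ is the solution on $\mathbb{R}^n$ of \[ X^n_0=x^n_0,\quad \mathrm{d}X_t^{n,i}=\sqrt{\tfrac2n}\,\mathrm{d}B^i_t-X_t^{n,i}\,\mathrm{d}t+\frac\beta n\sum_{j\ne i}\frac{\mathrm{d}t}{X_t^{n,i}-X_t^{n,j}},\quad 1\le i\le n, \] with $B$ a standard $n$-dimensional Brownian motion. If $\beta=0$ then $x_0^n\in\mathbb{R}^n$ and $P_n^0=\mathcal{N}(0,\frac1nI_n)$. If $\beta\ge1$ then $x_0^n\in\overline D_n=\{x\in\mathbb{R}^n:x_1\le\cdots\le x_n\}$; there is a unique strong solution, almost surely $X^n_t\in D_n=\{x_1<\cdots<x_n\}$ for all $t>0$ (the initial point may lie on the boundary), and the unique invariant law on $\overline D_n$ is $P_n^\beta$, with density proportional to $\mathrm{e}^{-\frac n2|x|^2}\prod_{i>j}(x_i-x_j)^\beta\mathbf{1}_{x\in\overline D_n}$. For probability measures $\nu,\mu$ on $\mathbb{R}^n$, $\mathrm{dist}(\nu\mid\mu)$ denotes one of: $\mathrm{Wasserstein}(\nu,\mu)=(\inf\mathbb{E}|X-Y|^2)^{1/2}$, infimum over couplings $X\sim\nu$, $Y\sim\mu$, $|\cdot|$ Euclidean; $\mathrm{TV}$: $\|\nu-\mu\|_{\mathrm{TV}}=\sup_A|\nu(A)-\mu(A)|$; $\mathrm{Hellinger}(\nu,\mu)=(1-\int\sqrt{f_\nu f_\mu}\,\mathrm{d}\lambda)^{1/2}$ where $f_\nu,f_\mu$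 are densities with respect to a common reference measure $\lambda$; $\mathrm{Kullback}(\nu\mid\mu)=\int\log\frac{\mathrm{d}\nu}{\mathrm{d}\mu}\,\mathrm{d}\nu$ and $\chi^2(\nu\mid\mu)=\int|\frac{\mathrm{d}\nu}{\mathrm{d}\mu}-1|^2\mathrm{d}\mu$, both set to $+\infty$ when $\nu$ is not absolutely continuous with respect to $\mu$. The value $\max$ is $1$ if $\mathrm{dist}\in\{\mathrm{TV},\mathrm{Hellinger}\}$ and $+\infty$ if $\mathrm{dist}\in\{\mathrm{Wasserstein},\mathrm{Kullback},\chi^2\}$. *)

(* Defs.v *)
From HB Require Import structures.
From mathcomp Require Import all_boot all_order all_algebra.
From mathcomp Require Import all_classical all_reals all_analysis.

Set Implicit Arguments.
Unset Strict Implicit.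
Unset Printing Implicit Defensive.

Import Order.TTheory GRing.Theory Num.Theory.
Import numFieldNormedType.Exports.

Local Open Scope classical_set_scope.
Local Open Scope ring_scope.

(* R^n, with the product of the Borel sigma-algebras *)
Notation Rn R n := (n.-tuple (measurableTypeR R)).

Section power_measure.
Context d (T : measurableType d) (R : realType).

Definition cons_pair n (z : T * n.-tuple T) : n.+1.-tuple T :=
  [tuple of z.1 :: z.2].

Definition uncons_pair n (x : n.+1.-tuple T) : T * n.-tuple T :=
  (thead x, [tuple of behead x]).

Lemma cons_pairK n : cancel (@cons_pair n) (@uncons_pair n).
Proof.
by case=> x t; rewrite /uncons_pair /cons_pair theadE; congr pair; apply/val_inj.
Qed.

Lemma uncons_pairK n : cancel (@uncons_pair n) (@cons_pair n).
Proof. by move=> x; rewrite /cons_pair /uncons_pair [RHS]tuple_eta. Qed.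

Lemma measurable_cons_pair n :
  measurable_fun [set: T * n.-tuple T] (@cons_pair n).
Proof. exact: measurable_cons. Qed.

Lemma measurable_uncons_pair n :
  measurable_fun [set: n.+1.-tuple T] (@uncons_pair n).
Proof.
apply/measurable_fun_pairP; split; last exact: measurable_behead.
exact: (@measurable_tnth _ _ _ ord0).
Qed.

Section cons_measure.
Variables (mu : {sigma_finite_measure set T -> \bar R}) (n : nat).
Variable nu : {sigma_finite_measure set (n.-tuple T) -> \bar R}.

Definition cons_measure : set (n.+1.-tuple T) -> \bar R :=
  pushforward (mu \x nu)%E (@cons_pair n).

Let mcons := @measurable_cons_pair n.

Let cons_measure0 : cons_measure set0 = 0%E.
Proof. by rewrite /cons_measure /pushforward preimage_set0 measure0. Qed.

Let cons_measure_ge0 A : (0 <= cons_measure A)%E.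
Proof. exact: measure_ge0. Qed.

Let cons_measure_sigma_additive : semi_sigma_additive cons_measure.
Proof. exact: measure_semi_sigma_additive. Qed.

HB.instance Definition _ := isMeasure.Build _ _ _ cons_measure
  cons_measure0 cons_measure_ge0 cons_measure_sigma_additive.

Let cons_measure_sigma_finite : sigma_finite setT cons_measure.
Proof.
have /sigma_finiteP[F [TF ndF Foo]] := sigma_finiteT mu.
have /sigma_finiteP[G [TG ndG Goo]] := sigma_finiteT nu.
exists (fun i => @uncons_pair n @^-1` (F i `*` G i)).
  rewrite -preimage_bigcup (_ : \bigcup_i (F i `*` G i) = setT)//.
  rewrite -setXTT TF TG predeqE => -[x y]; split.
    by move=> [i _ []/= ? ?]; split; exists i.
  move=> [/= [i _ Fix] [k _ Gky]]; exists (maxn i k) => //; split.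
  - by move: x Fix; exact/subsetPset/ndF/leq_maxl.
  - by move: y Gky; exact/subsetPset/ndG/leq_maxr.
move=> i; have [mFi Fi_fin] := Foo i; have [mGi Gi_fin] := Goo i; split.
  rewrite -[X in measurable X]setTI.
  by apply: measurable_uncons_pair => //; exact: measurableX.
rewrite /cons_measure /pushforward -comp_preimage.
rewrite (_ : _ \o _ = id); last by apply/funext => z; exact: cons_pairK.
by rewrite preimage_id product_measure1E// lte_mul_pinfty// ge0_fin_numE.
Qed.

HB.instance Definition _ := Measure_isSigmaFinite.Build _ _ _ cons_measure
  cons_measure_sigma_finite.

End cons_measure.

(* The n-fold product of mu with itself, on T^n *)
Fixpoint power_measure (mu : {sigma_finite_measure set T -> \bar R}) (n : nat) :
    {sigma_finite_measure set (n.-tuple T) -> \bar R} :=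
  match n with
  | 0 => \d_([tuple] : 0.-tuple T)
  | n'.+1 => cons_measure mu (power_measure mu n')
  end.

End power_measure.

Section distances.
Context {R : realType}.
Local Open Scope charge_scope.
Local Open Scope ereal_scope.

Section generic.
Context d (T : measurableType d).

Lemma measure_add_fin_num (m1 m2 : {finite_measure set T -> \bar R}) :
  fin_num_fun (measure_add m1 m2).
Proof.
by move=> A mA; rewrite measure_addE fin_numD !fin_num_measure.
Qed.

HB.instance Definition _ (m1 m2 : {measure set T -> \bar R}) :=
  Measure.copy (measure_add m1 m2)
    (msum (fun n => if n is 0%N then m1 else m2) 2).

HB.instance Definition _ (m1 m2 : {finite_measure set T -> \bar R}) :=
  Measure_isFinite.Build _ _ _ (measure_add m1 m2)
    (@measure_add_fin_num m1 m2).

(* 'd (charge_of_finite_measure nu) '/d mu is a representative with finite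
   values, meaningful only when nu `<< mu. *)
Definition density (nu : {finite_measure set T -> \bar R})
    (mu : {sigma_finite_measure set T -> \bar R}) : T -> \bar R :=
  'd (charge_of_finite_measure nu) '/d mu.

Implicit Types nu mu : probability T R.

Definition total_variation nu mu : \bar R :=
  ereal_sup [set `|nu A - mu A| | A in measurable].

(* The reference measure is nu + mu, which dominates both arguments; the value
   does not depend on this choice. *)
Definition hellinger nu mu : \bar R :=
  let lambda := measure_add nu mu in
  sqrte (1 - \int[lambda]_x sqrte (density nu lambda x * density mu lambda x)).

Definition kullback nu mu : \bar R :=
  if `[< nu `<< mu >] then \int[nu]_x lne (density nu mu x) else +oo.

Definition chi2 nu mu : \bar R :=
  if `[< nu `<< mu >] then \int[mu]_x (`|density nu mu x - 1| ^+ 2) else +oo.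

Definition coupling nu mu : set (probability (T * T)%type R) :=
  [set g | forall A, measurable A ->
    g (fst @^-1` A) = nu A /\ g (snd @^-1` A) = mu A].

End generic.

Definition wasserstein n (nu mu : probability (Rn R n) R) : \bar R :=
  sqrte (ereal_inf
    [set \int[g]_z (\sum_(i < n) (tnth z.1 i - tnth z.2 i) ^+ 2)%R%:E
       | g in coupling nu mu]).

End distances.

Inductive distance := TV | Hellinger | Kullback | Chi2 | Wasserstein.

Definition dist {R : realType} (D : distance) n (nu mu : probability (Rn R n) R) :
    \bar R :=
  match D with
  | TV => total_variation nu mu
  | Hellinger => hellinger nu mu
  | Kullback => kullback nu mu
  | Chi2 => chi2 nu mu
  | Wasserstein => wasserstein nu mu
  end.

Definition dist_max {R : realType} (D : distance) : \bar R :=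
  match D with
  | TV | Hellinger => 1%E
  | Kullback | Chi2 | Wasserstein => +oo%E
  end.

Section dou.
Context {R : realType}.
Implicit Types (beta s t : R) (n : nat).

Definition lebesgue_Rn n : {sigma_finite_measure set (Rn R n) -> \bar R} :=
  power_measure (@lebesgue_measure R) n.

(* N(0, s^2 I_n), for s != 0: normal_prob takes the standard deviation. *)
Definition gaussian_Rn n s : {sigma_finite_measure set (Rn R n) -> \bar R} :=
  power_measure (normal_prob 0 s) n.

Definition chamber n : set (Rn R n) :=
  [set x | forall i j : 'I_n, (i < j)%N -> tnth x i < tnth x j].

Definition closed_chamber n : set (Rn R n) :=
  [set x | forall i j : 'I_n, (i <= j)%N -> tnth x i <= tnth x j].

Definition state_space beta n : set (Rn R n) :=
  if beta == 0 then setT else @closed_chamber n.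

Definition dou_weight beta n (x : Rn R n) : R :=
  expR (- (n%:R / 2) * \sum_(i < n) tnth x i ^+ 2) *
  \prod_(i < n) \prod_(j < n | (j < i)%N) (tnth x i - tnth x j) `^ beta.

(* mu is the law P_n^beta. *)
Definition dou_invariant_law beta n (mu : probability (Rn R n) R) : Prop :=
  if beta == 0 then
    forall A, measurable A -> mu A = gaussian_Rn n (Num.sqrt (n%:R^-1)) A
  else
    exists2 c : R, 0 < c & forall A, measurable A ->
      mu A = (c%:E * \int[lebesgue_Rn n]_(x in A `&` @closed_chamber n)
                       (dou_weight beta x)%:E)%E.

Section processes.
Context d (Om : measurableType d) (P : probability Om R).
(* Time is a real number; only its values in [0, +oo[ are relevant. *)
Implicit Types (F : R -> set (set Om)).

Definition filtration F : Prop :=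
  [/\ forall t, 0 <= t -> sigma_algebra setT (F t),
      forall t, 0 <= t -> F t `<=` measurable
    & forall s t, 0 <= s -> s <= t -> F s `<=` F t].

Definition adapted F n (X : R -> Om -> Rn R n) : Prop :=
  forall t, 0 <= t -> forall A, measurable A -> F t (X t @^-1` A).

Definition continuous_path n (x : R -> Rn R n) : Prop :=
  forall i : 'I_n, {within `[0, +oo[, continuous (fun t => tnth (x t) i : R)}.

(* Standard n-dimensional F-Brownian motion: for s < t the increment on [s, t]
   is independent of F s and has law N(0, (t - s) I_n). *)
Definition brownian_motion F n (B : R -> Om -> Rn R n) : Prop :=
  [/\ adapted F B,
      {ae P, forall w, forall i, tnth (B 0 w) i = 0},
      {ae P, forall w, continuous_path (B ^~ w)}
    & forall s t, 0 <= s -> s < t ->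
      forall E A, F s E -> measurable A ->
        P (E `&` [set w | A [tuple tnth (B t w) i - tnth (B s w) i | i < n]]) =
        (P E * gaussian_Rn n (Num.sqrt (t - s)) A)%E].

(* The path x solves the equation driven by the path b. The noise is additive,
   so the equation is a pathwise integral equation. When beta = 0 there is no
   interaction term and the constraints attached to it are dropped. *)
Definition dou_path beta n (x0 : Rn R n) (b x : R -> Rn R n) : Prop :=
  [/\ x 0 = x0,
      continuous_path x,
      beta != 0 -> forall t, 0 < t -> chamber (x t),
      beta != 0 -> forall t, 0 <= t -> forall i j : 'I_n, j != i ->
        lebesgue_measure.-integrable `[0, t]
          (fun s => ((tnth (x s) i - tnth (x s) j)^-1)%:E)
    & forall t, 0 <= t -> forall i : 'I_n,
        tnth (x t) i = tnth x0 i + Num.sqrt (2 / n%:R) * tnth (b t) i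
          - \int[lebesgue_measure]_(s in `[0, t]) tnth (x s) i
          + beta / n%:R * \sum_(j < n | j != i)
              \int[lebesgue_measure]_(s in `[0, t])
                (tnth (x s) i - tnth (x s) j)^-1].

Definition dou_process beta n (x0 : Rn R n) (X : R -> {RV P >-> Rn R n}) : Prop :=
  exists F (B : R -> Om -> Rn R n),
    [/\ filtration F, brownian_motion F B, adapted F X
      & {ae P, forall w, dou_path beta x0 (B ^~ w) (fun t => X t w)}].

End processes.

Definition coord_sum n (x : Rn R n) : R := \sum_(i < n) tnth x i.

(* ln is extended by ln 0 = 0; since c_n is assumed to tend to +oo, this only
   concerns finitely many n. *)
Definition cutoff_time (D : distance) n (x : Rn R n) : R :=
  match D with
  | Wasserstein => ln (`|coord_sum x| / Num.sqrt n%:R)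
  | _ => ln `|coord_sum x|
  end.

End dou.

(* Main.v *)
Require Import Defs.
From mathcomp Require Import all_boot all_order all_algebra.
From mathcomp Require Import all_classical all_reals all_analysis.
From mathcomp Require Import measurable_realfun.
From mathcomp Require Import ring lra.

Set Implicit Arguments.
Unset Strict Implicit.
Unset Printing Implicit Defensive.

Import Order.TTheory GRing.Theory Num.Theory.
Import numFieldNormedType.Exports.

Local Open Scope classical_set_scope.
Local Open Scope ring_scope.

(** The coordinate sum [S_t = coord_sum (X_t)] of the process solves a scalar
linear equation: the interaction terms [1 / (X^i - X^j)] are antisymmetric, so
they cancel, and [S] is an Ornstein-Uhlenbeck process driven by
[sqrt (2 / n) * sum_i B^i], whose increment over a time [u] has law
[N(0, 2 u)]. Hence [S_t = exp (- t) * S_0 + O(1)], with a random [O(1)] that is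
tight uniformly in [n] and [t] ([dou_tail]). Under the invariant law,
[coord_sum] is tight uniformly in [n] as well ([invariant_law_tail]). Write
[r = exp (- t) * |S_0|]. At time [(1 - eps) * c_n], [r] equals [exp (eps * c_n)],
or [sqrt n * exp (eps * c_n)] for the Wasserstein distance
([mean_at_cutoff]), and this tends to infinity. So the event
[r / 2 <= |coord_sum x|] has probability close to 1 under the law of the
process and close to 0 under the invariant law.

For two laws that are almost carried by disjoint events, the total variation
and Hellinger distances are close to 1 and the Kullback and chi-square
divergences are large ([dist_cvg_max]). Apart from the total variation, the
lower bounds come from pointwise inequalities for the densities, integrated
over the separating event and its complement. For the Wasserstein distance,
[(coord_sum x - coord_sum y)^2 <= n * |x - y|^2] turns the separation of the two
coordinate sums into a transport cost of order [r ^ 2 / n]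
([wasserstein_ge]).

Two points avoid stochastic calculus. First, the tail of [S_t] is read off the
path: an implicit Euler scheme ([implicit_euler]) bounds
[exp (- t) * |S_0| - |S_t|] by a weighted sum of the variables [|Y_t - Y_s|],
[Y] being the driving noise, up to an error that vanishes with the step. Only
the laws of the increments enter the expectation of that sum, and a Fatou
argument ([probability_le_eventually]) passes to the limit. Second, the tail
under the invariant law follows from the identity
[E exp (coord_sum) = exp (1 / 2)], obtained for [beta >= 1] by translating the
density along the diagonal, a direction in which the interaction does not
change. *)

(** * Measurability and integration *)

Section preliminaries.
Context {R : realType}.

Lemma measurable_set_ler d (T : measurableType d) (f g : T -> R) :
  measurable_fun setT f -> measurable_fun setT g ->
  measurable [set x | f x <= g x].
Proof.
move=> mf mg; rewrite -[X in measurable X]setTI.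
by have := measurable_fun_ler mf mg; apply.
Qed.

Lemma measurable_set_ltr d (T : measurableType d) (f : T -> R) (K : R) :
  measurable_fun setT f -> measurable [set x | f x < K].
Proof.
move=> mf; rewrite (_ : [set _ | _] = ~` [set x | K <= f x]).
  by apply: measurableC; exact: (measurable_set_ler (f := cst K)).
by apply/seteqP; split=> x /=; rewrite ltNge => /negP.
Qed.

(** Fatou's lemma for events: up to a null set, [A] is included in the increasing
union over [M] of the intersections of the [G m], [m >= M], and each of these
has probability at most [c]. *)
Lemma probability_le_eventually d (Om : measurableType d) (P : probability Om R)
    (A : set Om) (G : nat -> set Om) (c : \bar R) :
  measurable A -> (forall m, measurable (G m)) -> (forall m, (P (G m) <= c)%E) ->
  {ae P, forall w, A w -> \forall m \near \oo, G m w} -> (P A <= c)%E.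
Proof.
move=> mA mG Gc [N [mN PN AN]].
pose B M := \bigcap_(m in [set m | (M <= m)%N]) G m.
have mB M : measurable (B M) by apply: bigcap_measurable => //; exists M => /=.
have mUB : measurable (\bigcup_M B M) by exact: bigcup_measurable.
have B_nd : nondecreasing_seq B.
  move=> M M' MM'; apply/subsetPset => w BMw m /= M'm.
  by apply: BMw => /=; exact: leq_trans MM' M'm.
have PUB : (P (\bigcup_M B M) <= c)%E.
  have cvgB := nondecreasing_cvg_mu (mu := P) mB mUB B_nd.
  rewrite -(cvg_lim _ cvgB)//; apply: lime_le; first by apply/cvg_ex; eexists; exact: cvgB.
  apply: nearW => M /=; apply: le_trans (Gc M); apply: le_measure; rewrite ?inE//.
  by move=> w; apply => /=.
apply: (@le_trans _ _ (P ((\bigcup_M B M) `|` N))).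
  apply: le_measure; rewrite ?inE//; first exact: measurableU.
  move=> w Aw; have [wN|/negP] := boolP (w \in N); first by right; rewrite inE in wN.
  rewrite inE => wN; left.
  have /contrapT/(_ Aw) : ~ ~ (A w -> \forall m \near \oo, G m w).
    by move=> h; apply: wN; exact: AN.
  by move=> [M _ hM]; exists M.
apply: le_trans (measureU2 _ mUB mN) _.
by rewrite [X in (_ + X)%E]PN adde0.
Qed.

Lemma Rintegral_sum d (T : measurableType d) (mu : {measure set T -> \bar R})
    (A : set T) (I : Type) (s : seq I) (f : I -> T -> R) : measurable A ->
  (forall i, mu.-integrable A (EFin \o f i)) ->
  \int[mu]_(x in A) (\sum_(i <- s) f i x) = \sum_(i <- s) \int[mu]_(x in A) f i x.
Proof.
move=> mA intf; elim: s => [|i s IH].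
  by rewrite big_nil; under eq_Rintegral do rewrite big_nil; rewrite Rintegral_cst// mul0r.
rewrite big_cons -IH -RintegralD//.
  by apply: eq_Rintegral => x _; rewrite big_cons.
rewrite (_ : _ \o _ = fun x => (\sum_(i <- s) (f i x)%:E)%E); last first.
  by apply/funext => x /=; rewrite sumEFin.
by apply: integrable_sum => // j _; exact: intf.
Qed.

End preliminaries.

Section densities.
Context {R : realType} d (T : measurableType d).
Local Open Scope ereal_scope.

(** The functions [lne] and [sqrte] are only composed with densities, which are
finite everywhere; this reduces measurability to that of [ln] and [Num.sqrt]. *)
Lemma measurable_lne (f : T -> \bar R) : (forall x, f x \is a fin_num) ->
  measurable_fun setT f -> measurable_fun setT (fun x => lne (f x)).
Proof.
move=> ffin mf.
have mr : measurable_fun setT (fine \o f).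
  by apply/measurable_EFinP; rewrite (_ : _ \o _ = f)//; apply/funext => x /=; rewrite fineK.
rewrite (_ : (fun _ => _) = fun x => if (fine (f x) <= 0)%R then -oo
                                     else (ln (fine (f x)))%:E).
  apply: measurable_fun_ifT => //; first exact: measurable_fun_ler.
  by apply/measurable_EFinP; apply: measurableT_comp mr; exact: measurable_ln.
by apply/funext => x; rewrite -{1}(fineK (ffin x)).
Qed.

Lemma measurable_sqrte (f : T -> \bar R) : (forall x, f x \is a fin_num) ->
  measurable_fun setT f -> measurable_fun setT (fun x => sqrte (f x)).
Proof.
move=> ffin mf.
have mr : measurable_fun setT (fine \o f).
  by apply/measurable_EFinP; rewrite (_ : _ \o _ = f)//; apply/funext => x /=; rewrite fineK.
rewrite (_ : (fun _ => _) = fun x => (Num.sqrt (fine (f x)))%:E).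
  apply/measurable_EFinP; apply: measurableT_comp mr.
  by apply: continuous_measurable_fun; exact: sqrt_continuous.
by apply/funext => x; rewrite -{1}(fineK (ffin x)).
Qed.

(** Meant for an [L] whose positive part may have an infinite integral, as the
logarithm of a density does: positive and negative parts are monotone
separately. *)
Lemma measurable_le_integral (L h : T -> \bar R) (m : {measure set T -> \bar R}) :
  measurable_fun setT L -> measurable_fun setT h -> (forall x, h x <= L x) ->
  \int[m]_x h x <= \int[m]_x L x.
Proof.
move=> mL mh hL; rewrite [leLHS]integralE [leRHS]integralE.
apply: leeB; apply: ge0_le_integral => //.
- exact: measurable_funepos.
- exact: measurable_funepos.
- by move=> x _; apply: (@funepos_le _ _ setT) => //; rewrite inE.
- exact: measurable_funeneg.
- exact: measurable_funeneg.
- by move=> x _; apply: (@funeneg_le _ _ setT) => //; rewrite inE.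
Qed.

(** A representative of the density with nonnegative real values. The
nonnegativity matters because [density] may be negative on a null set, and the
formula for [\int[nu]] must hold for all nonnegative [g], integrable or not. *)
Lemma density_realE (nu : {finite_measure set T -> \bar R})
    (mu : {sigma_finite_measure set T -> \bar R}) : nu `<< mu ->
  exists p : T -> R, [/\ measurable_fun setT p, forall x, (0 <= p x)%R,
    ae_eq mu setT (density nu mu) (EFin \o p) &
    forall (g : T -> \bar R) A, measurable A -> measurable_fun A g ->
      (forall x, 0 <= g x) ->
      \int[nu]_(x in A) g x = \int[mu]_(x in A) (g x * (p x)%:E)].
Proof.
move=> numu; pose f := Radon_Nikodym_SigmaFinite.f nu mu.
have ffin x : f x \is a fin_num by exact: Radon_Nikodym_SigmaFinite.f_fin_num.
have fE : EFin \o (fine \o f) = f.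
  by apply/funext => x /=; rewrite fineK.
have mf : measurable_fun setT f.
  exact: measurable_int (Radon_Nikodym_SigmaFinite.f_integrable numu).
exists (fine \o f); split.
- by apply/measurable_EFinP; rewrite fE.
- by move=> x; apply: fine_ge0; exact: Radon_Nikodym_SigmaFinite.f_ge0.
- rewrite fE; apply: ae_eq_sym.
  exact: ae_eq_Radon_Nikodym_SigmaFinite.
- move=> g A mA mg g0.
  rewrite -(Radon_Nikodym_SigmaFinite.change_of_variables numu g0)//.
  by apply: eq_integral => x _ /=; rewrite fineK.
Qed.

Lemma dominates_density_measurable (nu : {finite_measure set T -> \bar R})
    (mu : {sigma_finite_measure set T -> \bar R}) : nu `<< mu ->
  measurable_fun setT (density nu mu).
Proof.
move=> numu; rewrite /density.
exact: measurable_int (Radon_Nikodym_integrable _).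
Qed.

(** A density [r] given through the measures of sets also computes integrals: it
is almost everywhere equal to the Radon-Nikodym representative. *)
Lemma integral_density (nu : {finite_measure set T -> \bar R})
    (mu : {sigma_finite_measure set T -> \bar R}) (r : T -> R) :
  measurable_fun setT r -> (forall x, (0 <= r x)%R) ->
  (forall A, measurable A -> nu A = \int[mu]_(x in A) (r x)%:E) ->
  forall f : T -> \bar R, measurable_fun setT f -> (forall x, 0 <= f x) ->
  \int[nu]_x f x = \int[mu]_x (f x * (r x)%:E).
Proof.
move=> mr r0 nuE f mf f0.
have numu : nu `<< mu.
  apply/null_content_dominatesP => A mA muA; rewrite nuE//.
  by apply: null_set_integral => //; apply/measurable_EFinP; exact: measurable_funTS.
have [p [mp p0 _ pE]] := density_realE numu.
rewrite pE//.
have ir : mu.-integrable setT (EFin \o r).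
  apply/integrableP; split; first exact/measurable_EFinP.
  under eq_integral do rewrite /= ger0_norm//.
  by rewrite -nuE// ltey_eq fin_num_measure.
have rp : ae_eq mu setT (EFin \o r) (EFin \o p).
  apply: integral_ae_eq => //; first exact/measurable_EFinP.
  move=> A _ mA; rewrite -nuE// -[nu A]mul1e -integral_cst// pE//.
  by apply: eq_integral => x _; rewrite mul1e.
apply: ge0_ae_eq_integral => //.
- by apply: emeasurable_funM => //; exact/measurable_EFinP.
- by apply: emeasurable_funM => //; exact/measurable_EFinP.
- by move=> x _; rewrite mule_ge0// lee_fin.
- by move=> x _; rewrite mule_ge0// lee_fin.
- by move: rp; apply: filterS => x /(_ I) /= <- _.
Qed.

End densities.

(** * Distances between nearly singular laws *)

Section total_variation_chi2.
Context {R : realType} d (T : measurableType d).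
Local Open Scope ereal_scope.
Implicit Types A : set T.

Variables nu mu : probability T R.

Lemma total_variation_le1 : Defs.total_variation nu mu <= 1.
Proof.
apply: ge_ereal_sup => _ [A mA <-].
have nuA : nu A \is a fin_num by exact: fin_num_measure.
have muA : mu A \is a fin_num by exact: fin_num_measure.
have nu0 : (0 <= fine (nu A))%R by exact: fine_ge0.
have mu0 : (0 <= fine (mu A))%R by exact: fine_ge0.
have := probability_le1 nu mA; have := probability_le1 mu mA.
rewrite -(fineK nuA) -(fineK muA) -EFinB abse_EFin !lee_fin => mu1 nu1.
by rewrite ler_norml; apply/andP; split; lra.
Qed.

Lemma total_variation_ge_diff A : measurable A ->
  nu A - mu A <= Defs.total_variation nu mu.
Proof.
move=> mA; apply: le_trans (lee_abs _) _.
by apply: ereal_sup_ubound; exists A.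
Qed.

(** Integrate [(p - 1)^2 >= 2 K (p - 1) - K^2] over [A], where [p] is the
density; the optimal [K] would give the Cauchy-Schwarz bound. *)
Lemma chi2_ge A (K : R) : measurable A -> (0 <= K)%R ->
  (2 * K)%:E * nu A <= chi2 nu mu + (2 * K + K ^+ 2)%:E * mu A.
Proof.
move=> mA K0; rewrite /chi2; case: asboolP => [numu|_]; last first.
  by rewrite addye ?leey// gt_eqF// (@lt_le_trans _ _ 0)// mule_ge0// lee_fin addr_ge0 ?mulr_ge0 ?sqr_ge0.
have [p [mp p0 pE nuE]] := density_realE numu.
have md := dominates_density_measurable numu.
have mp1 : measurable_fun setT (fun x => ((p x - 1) ^+ 2)%:E).
  by apply/measurable_EFinP/measurable_funX/measurable_funB.
have -> : \int[mu]_x (`|density nu mu x - 1| ^+ 2) =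
          \int[mu]_x ((p x - 1) ^+ 2)%:E.
  apply: ge0_ae_eq_integral => //.
  - have md1 : measurable_fun setT (fun x => `|density nu mu x - 1|).
      by apply: measurableT_comp => //; apply: emeasurable_funB.
    by apply: (emeasurable_funM md1 md1).
  - by move=> x _; exact: sqre_ge0.
  - by move=> x _; rewrite lee_fin sqr_ge0.
  - move: pE; apply: filterS => x /(_ I) + _ => ->.
    by rewrite -EFinB abse_EFin -EFin_expe real_normK// num_real.
have -> : (2 * K)%:E * nu A = \int[mu]_(x in A) (2 * K * p x)%:E.
  by rewrite -integral_cst// nuE// => x; rewrite lee_fin mulr_ge0.
apply: (@le_trans _ _ (\int[mu]_(x in A) ((p x - 1) ^+ 2)%:E +
                       \int[mu]_(x in A) (2 * K + K ^+ 2)%:E)).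
  rewrite -ge0_integralD//; last 3 first.
  - by move=> x _; rewrite lee_fin sqr_ge0.
  - exact: measurable_funTS.
  - by move=> x _; rewrite lee_fin addr_ge0 ?mulr_ge0 ?sqr_ge0.
  apply: ge0_le_integral => //.
  - by move=> x _; rewrite lee_fin mulr_ge0// mulr_ge0.
  - by apply/measurable_EFinP/measurable_funM => //; exact: measurable_funTS.
  - apply: emeasurable_funD => //; exact: measurable_funTS.
  - move=> x _; rewrite -EFinD lee_fin -subr_ge0.
    have -> : ((p x - 1) ^+ 2 + (2 * K + K ^+ 2) - 2 * K * p x =
               (p x - 1 - K) ^+ 2)%R by ring.
    exact: sqr_ge0.
rewrite integral_cst//; apply: leeD => //; apply: ge0_subset_integral => //.
by move=> x _; rewrite lee_fin sqr_ge0.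
Qed.

End total_variation_chi2.

Section separation_kullback.
Context {R : realType} d (T : measurableType d).
Local Open Scope ereal_scope.
Implicit Types A : set T.

Lemma ln_ge1BV (y : R) : (0 < y)%R -> (1 - y^-1 <= ln y)%R.
Proof.
move=> y0; have y1 : (0 < y^-1)%R by rewrite invr_gt0.
have : (ln (1 + (y^-1 - 1)) <= y^-1 - 1)%R by apply: le_ln1Dx; lra.
by rewrite addrCA subrr addr0 lnV ?posrE//; lra.
Qed.

Variables nu mu : probability T R.

(** Gibbs variational principle for the test function [g] equal to [K] on [A]
and to 0 elsewhere. Pointwise, [ln p >= g + 1 - exp g / p], with equality when
[g = ln p]; integrating against [nu] turns the last term into at
most [\int[mu] exp g]. *)
Lemma kullback_ge A (K : R) : measurable A ->
  K%:E * nu A <= kullback nu mu + (expR K)%:E * mu A.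
Proof.
move=> mA; rewrite /kullback; case: asboolP => [numu|_]; last first.
  by rewrite addye ?leey// gt_eqF// (@lt_le_trans _ _ 0)// mule_ge0// lee_fin expR_ge0.
have [p [mp p0 pE nuE]] := density_realE numu.
have md := dominates_density_measurable numu.
(* On the [nu]-null set where the density vanishes it is replaced by 1, so that
   the lower bound on the logarithm holds at every point. *)
pose Z := p @^-1` [set 0%R].
have mZ : measurable Z by rewrite /Z -[X in measurable X]setTI; exact: mp.
have nuZ : nu Z = 0.
  rewrite -[nu Z]mul1e -integral_cst// nuE//.
  by apply: integral0_eq => x -> ; rewrite mule0.
pose p' x := (p x + \1_Z x)%R.
have mp' : measurable_fun setT p' by exact: measurable_funD.
have p'0 x : (0 < p' x)%R.
  rewrite /p' indicE; have [xZ|/negP xZ] := boolP (x \in Z).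
    by rewrite ltr_wpDl.
  rewrite addr0 lt_neqAle p0 andbT; apply/eqP => px; apply: xZ.
  by rewrite inE /Z /= -px.
have pp' x : (p x <= p' x)%R by rewrite lerDl.
pose l x := ln (p' x).
have ml : measurable_fun setT l.
  by apply: measurableT_comp mp'; exact: measurable_ln.
have -> : \int[nu]_x lne (density nu mu x) = \int[nu]_x (l x)%:E.
  apply: ae_eq_integral => //.
  - by apply: measurable_lne => // x; exact: Radon_Nikodym_fin_num.
  - exact/measurable_EFinP.
  - have h1 := null_dominates_ae_eq measurableT numu pE.
    have h2 : {ae nu, forall x, ~ Z x}.
      by exists Z; split => // x /= /contrapT.
    apply: filterS2 h1 h2 => x + nZ _ => /(_ I) -> /=.
    have -> : p x = p' x by rewrite /p' indicE memNset// addr0.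
    by rewrite leNgt p'0.
pose a x := (K * \1_A x + 1)%R.
pose u x := (1 + expR K * \1_A x)%R.
(* [u] bounds the exponential of [g], and [b] is [u / p']: the function [a - b]
   is an integrable minorant of the logarithm of the density. *)
pose b x := (u x * expR (- l x))%R.
have u0 x : (0 <= u x)%R by rewrite addr_ge0// mulr_ge0// expR_ge0.
have b0 x : (0 <= b x)%R by rewrite mulr_ge0// expR_ge0.
have bE x : (b x * p' x = u x)%R.
  by rewrite /b /l expRN lnK ?posrE// mulfVK// gt_eqF.
have ma : measurable_fun setT a.
  by apply: measurable_funD => //; apply: measurable_funM.
have mu1 : measurable_fun setT u.
  by apply: measurable_funD => //; apply: measurable_funM.
have mb : measurable_fun setT b.
  apply: measurable_funM => //; apply: measurableT_comp => //.
  exact: measurable_funN.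
have mA1 : forall m : probability T R, \int[m]_x (\1_A x)%:E = m A.
  by move=> m; rewrite integral_indic// setIT.
have mT1 (m : probability T R) : \int[m]_x 1 = 1.
  rewrite integral_cst// mul1e; exact: probability_setT.
have intb : \int[nu]_x (b x)%:E <= 1 + (expR K)%:E * mu A.
  rewrite nuE//; last exact/measurable_EFinP.
  apply: (@le_trans _ _ (\int[mu]_x (u x)%:E)).
    apply: ge0_le_integral => //.
    - by move=> x _; rewrite mule_ge0// lee_fin.
    - by apply/measurable_EFinP/measurable_funM.
    - exact/measurable_EFinP.
    - by move=> x _; rewrite -EFinM lee_fin -bE ler_wpM2l.
  under eq_integral do rewrite /u EFinD EFinM.
  rewrite ge0_integralD//; last by apply/measurable_EFinP/measurable_funM.
  rewrite ge0_integralZl ?lee_fin ?expR_ge0//; last exact/measurable_EFinP.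
  by rewrite mA1 mT1.
have iA : nu.-integrable setT (fun x => K%:E * (\1_A x)%:E).
  by apply: integrableZl => //; exact: integrable_indic.
have i1 : nu.-integrable setT (fun=> 1).
  exact: (finite_measure_integrable_cst nu 1%R).
have ia : nu.-integrable setT (EFin \o a) by exact: (integrableD _ iA i1).
have ib : nu.-integrable setT (EFin \o b).
  apply/integrableP; split; first exact/measurable_EFinP.
  under eq_integral do rewrite /= ger0_norm//.
  apply: le_lt_trans intb _.
  by rewrite lte_add_pinfty ?ltry// lte_mul_pinfty ?lee_fin ?expR_ge0// ltey_eq fin_num_measure.
have intab : \int[nu]_x ((a x)%:E - (b x)%:E) <= \int[nu]_x (l x)%:E.
  apply: measurable_le_integral.
  - exact/measurable_EFinP.
  - by apply/measurable_EFinP/measurable_funB.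
  - move=> x; rewrite -EFinB lee_fin /a /b /u expRN lnK ?posrE// indicE.
    have y0 := p'0 x; have e0 := expR_gt0 K.
    have [xA|xA] := boolP (x \in A) => /=.
    + have := @ln_ge1BV (p' x / expR K) (divr_gt0 y0 e0).
      rewrite ln_div ?posrE// expRK invf_div /l.
      have : (0 <= (p' x)^-1)%R by rewrite invr_ge0 ltW.
      move: (p' x)^-1%R (ln _) => i w *; lra.
    + have := ln_ge1BV y0; rewrite /l.
      move: (p' x)^-1%R (ln _) => i w *; lra.
have inta : \int[nu]_x (a x)%:E = K%:E * nu A + 1.
  under eq_integral do rewrite /a EFinD EFinM.
  rewrite integralD//.
  rewrite integralZl//; last exact: integrable_indic.
  by rewrite mA1 mT1.
have finb : \int[nu]_x (b x)%:E \is a fin_num by exact: integrable_fin_num.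
move: intab; rewrite integralB_EFin// inta leeBlDr//.
move=> /le_trans/(_ (leeD2l _ intb)).
by rewrite addeA [X in _ <= X + _]addeC -addeA [X in _ <= X]addeC leeD2rE.
Qed.

End separation_kullback.

Section separation_hellinger.
Context {R : realType} d (T : measurableType d).
Local Open Scope ereal_scope.
Implicit Types A : set T.

(** Weighted form of [sqrt (p q) <= p + q]: the weight puts the small factor on
the density that carries little mass on the set of integration. *)
Lemma sqrt_young (s p q : R) : (0 < s)%R -> (0 <= p)%R -> (0 <= q)%R ->
  (Num.sqrt (p * q) <= s * p + s^-1 * q)%R.
Proof.
move=> s0 p0 q0; have i0 : (0 < s^-1)%R by rewrite invr_gt0.
have a0 : (0 <= s * p)%R by rewrite mulr_ge0// ltW.
have b0 : (0 <= s^-1 * q)%R by rewrite mulr_ge0// ltW.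
rewrite -[leRHS]ger0_norm ?addr_ge0// -sqrtr_sqr ler_wsqrtr//.
have -> : (p * q = (s * p) * (s^-1 * q))%R by field; rewrite gt_eqF.
nra.
Qed.

Variables nu mu : probability T R.

Lemma hellinger_le1 : hellinger nu mu <= 1.
Proof.
rewrite /hellinger.
have : 0 <= \int[measure_add nu mu]_x sqrte (density nu (measure_add nu mu) x *
                                            density mu (measure_add nu mu) x).
  by apply: integral_ge0 => x _; exact: sqrte_ge0.
case: (\int[_]_x _) => [r| |]//=; rewrite !lee_fin => r0.
by rewrite -[leRHS]sqrtr1 ler_wsqrtr// gerBl.
Qed.

(** The affinity [\int sqrt (p q)] is at most [4 s]: on [A] the measure [mu] is
small, on its complement [nu] is, and [sqrt_young] with weights [s] and [s^-1]
respectively bounds each part by [2 s]. *)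
Lemma hellinger_ge A (s : R) : measurable A -> (0 < s)%R ->
  mu A <= (s ^+ 2)%:E -> nu (~` A) <= (s ^+ 2)%:E ->
  (1 - 4 * s)%:E <= hellinger nu mu.
Proof.
move=> mA s0 muA nuA; rewrite /hellinger.
set la := measure_add nu mu.
have [nula mula] : nu `<< la /\ mu `<< la.
  have laE B : la B = nu B + mu B by exact: measure_addE.
  split; apply/null_content_dominatesP => B mB /(etrans (esym (laE B)))/eqP;
  by rewrite padde_eq0// => /andP[/eqP ? /eqP ?].
have [p [mp p0 pE nuE]] := density_realE nula.
have [q [mq q0 qE muE]] := density_realE mula.
have mnu := dominates_density_measurable nula.
have mmu := dominates_density_measurable mula.
have finu x : density nu la x \is a fin_num by exact: Radon_Nikodym_fin_num.
have fimu x : density mu la x \is a fin_num by exact: Radon_Nikodym_fin_num.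
have ms : measurable_fun setT (fun x => Num.sqrt (p x * q x)).
  apply: measurableT_comp (measurable_funM mp mq).
  by apply: continuous_measurable_fun; exact: sqrt_continuous.
have -> : \int[la]_x sqrte (density nu la x * density mu la x) =
          \int[la]_x (Num.sqrt (p x * q x))%:E.
  apply: ae_eq_integral => //.
  - by apply: measurable_sqrte => [x|]; [rewrite fin_numM|exact: emeasurable_funM].
  - exact/measurable_EFinP.
  - by apply: filterS2 pE qE => x + + _ => /(_ I) -> /(_ I) ->.
have half B (r : R) : measurable B -> (0 < r)%R ->
    \int[la]_(x in B) (Num.sqrt (p x * q x))%:E <= r%:E * nu B + r^-1%:E * mu B.
  move=> mB r0; have i0 : (0 < r^-1)%R by rewrite invr_gt0.
  rewrite -!integral_cst// nuE// ?muE//; last 2 first.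
    by move=> x; rewrite lee_fin ltW.
    by move=> x; rewrite lee_fin ltW.
  have mp1 : measurable_fun B (fun x => r%:E * (p x)%:E).
    by apply/measurable_EFinP/measurable_funM => //; exact: measurable_funTS.
  have mq1 : measurable_fun B (fun x => r^-1%:E * (q x)%:E).
    by apply/measurable_EFinP/measurable_funM => //; exact: measurable_funTS.
  rewrite -ge0_integralD//; last 2 first.
    by move=> x _; rewrite mule_ge0 ?lee_fin// ltW.
    by move=> x _; rewrite mule_ge0 ?lee_fin// ltW.
  apply: ge0_le_integral => //.
  - by apply/measurable_EFinP; exact: measurable_funTS.
  - exact: emeasurable_funD.
  - by move=> x _; rewrite -!EFinM -EFinD lee_fin sqrt_young.
have mC : measurable (~` A) by exact: measurableC.
have bound : \int[la]_x (Num.sqrt (p x * q x))%:E <= (4 * s)%:E.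
  rewrite -(setvU A) ge0_integral_setU//; last 2 first.
  - by apply/measurable_EFinP; exact: measurable_funTS.
  - by rewrite disj_set2E setICl.
  have ss : (s^-1 * s ^+ 2 = s)%R by rewrite expr2 mulKf// gt_eqF.
  have si0 : (0 < s^-1)%R by rewrite invr_gt0.
  have h1 := half _ _ mA s0; have h2 := half _ _ mC si0.
  have nu1 := probability_le1 nu mA; have mu1 := probability_le1 mu mC.
  have -> : (4 * s)%:E = (s%:E * 1 + s%:E) + (s%:E * 1 + s%:E).
    by rewrite mule1 -!EFinD; congr EFin; lra.
  apply: leeD.
    apply: le_trans h2 _; rewrite invrK addeC; apply: leeD.
      by rewrite lee_pmul2l.
    by rewrite -{2}ss EFinM lee_pmul2l.
  apply: le_trans h1 _; apply: leeD; first by rewrite lee_pmul2l.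
  by rewrite -{2}ss EFinM lee_pmul2l.
move: bound; have : 0 <= \int[la]_x (Num.sqrt (p x * q x))%:E.
  by apply: integral_ge0 => x _; rewrite lee_fin sqrtr_ge0.
case: (\int[la]_x _) => [r| |]//; rewrite !lee_fin => r0 rs /=.
have [s1|s1] := leP (1 - 4 * s)%R 0%R.
  by rewrite (le_trans s1)// sqrtr_ge0.
(* [sqrt (1 - r) >= 1 - 4 s] because [(1 - 4 s)^2 <= 1 - 4 s <= 1 - r]. *)
rewrite -(ger0_norm (ltW s1)) -sqrtr_sqr ler_wsqrtr//.
nra.
Qed.

End separation_hellinger.

Section separation_limits.
Context {R : realType}.
Local Open Scope ereal_scope.

Definition nearly_singular d (T : measurableType d) (a : R) (nu mu : probability T R) :=
  exists2 A : set T, measurable A & mu A <= a%:E /\ nu (~` A) <= a%:E.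

Lemma probability_ge_setC d (T : measurableType d) (nu : probability T R)
    (A : set T) (a : R) : measurable A -> nu (~` A) <= a%:E -> (1 - a)%:E <= nu A.
Proof.
move=> mA; rewrite probability_setC//.
have nuA : nu A \is a fin_num by exact: fin_num_measure.
by rewrite -(fineK nuA) -EFinB !lee_fin; lra.
Qed.

(** Common endgame of the Kullback and chi-square bounds, once [a] is small
compared with the constant [c] which depends on the target [M]. *)
Lemma lee_of_weighted d (T : measurableType d) (nu mu : probability T R)
    (A : set T) (a K c M : R) (x : \bar R) : measurable A ->
  mu A <= a%:E -> nu (~` A) <= a%:E -> (0 <= K)%R -> (0 <= c)%R ->
  (a <= 2^-1)%R -> (c * a <= 1)%R -> (M + 1 <= K / 2)%R ->
  K%:E * nu A <= x + c%:E * mu A -> M%:E <= x.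
Proof.
move=> mA muA nuA K0 c0 a2 ca MK h.
have nuA2 : (2^-1)%:E <= nu A.
  by apply: le_trans (probability_ge_setC mA nuA); rewrite lee_fin; lra.
have h1 : (K / 2)%:E <= x + 1.
  apply: (@le_trans _ _ (K%:E * nu A)); first by rewrite EFinM lee_wpmul2l.
  apply: le_trans h _; apply: leeD2l.
  apply: (@le_trans _ _ (c%:E * a%:E)); first by rewrite lee_wpmul2l.
  by rewrite -EFinM lee_fin.
move: x h1 {h} => [r| |]//; rewrite ?leey// -EFinD !lee_fin; lra.
Qed.

Lemma cvge1_of_le (u : nat -> \bar R) : (forall n, u n <= 1) ->
  (forall e : R, (0 < e)%R -> \forall n \near \oo, (1 - e)%:E <= u n) ->
  u @ \oo --> 1.
Proof.
move=> u1 ue; apply/fine_cvgP; split.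
  near=> n; have : (1 - 1)%:E <= u n by near: n; exact: ue.
  by have := u1 n; case: (u n).
apply/cvgrPdist_le => e e0; near=> n.
have : (1 - e)%:E <= u n by near: n; exact: ue.
have := u1 n; rewrite /=; case: (u n) => [r| |]//=; rewrite !lee_fin => r1 er.
by rewrite ger0_norm; lra.
Unshelve. all: by end_near. Qed.

(** The Wasserstein distance is excluded, since nearly singular laws may be
close to each other in transport distance. *)
Lemma dist_cvg_max (D : distance) (nu mu : forall n, probability (Rn R n) R) :
  D <> Wasserstein ->
  (forall a : R, (0 < a)%R -> \forall n \near \oo, nearly_singular a (nu n) (mu n)) ->
  dist D (nu n) (mu n) @[n --> \oo] --> dist_max D.
Proof.
move=> DW sep; case: D DW => // _ /=.
- apply: cvge1_of_le => [n|e e0]; first exact: total_variation_le1.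
  have e20 : (0 < e / 2)%R by rewrite divr_gt0.
  apply: filterS (sep _ e20) => n [A mA [muA nuA]].
  apply: le_trans (total_variation_ge_diff (nu n) (mu n) mA).
  rewrite (_ : (1 - e) = (1 - e / 2) - e / 2)%R; last by lra.
  by rewrite EFinB; apply: leeB => //; exact: probability_ge_setC.
- apply: cvge1_of_le => [n|e e0]; first exact: hellinger_le1.
  have e20 : (0 < (e / 4) ^+ 2)%R by rewrite exprn_gt0// divr_gt0.
  apply: filterS (sep _ e20) => n [A mA [muA nuA]].
  rewrite (_ : e = 4 * (e / 4))%R; last by lra.
  by apply: hellinger_ge mA _ muA nuA; rewrite divr_gt0.
- apply/cvgeyPge => M; pose K := (2 * (`|M| + 1))%R.
  have K0 : (0 <= K)%R by rewrite mulr_ge0// addr_ge0.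
  have a0 : (0 < Num.min 2^-1 (expR (- K)))%R by rewrite lt_min invr_gt0// expR_gt0 andbT.
  apply: filterS (sep _ a0) => n [A mA [muA nuA]].
  apply: lee_of_weighted mA muA nuA K0 (expR_ge0 K) _ _ _ (kullback_ge _ _ _ mA).
  + by rewrite ge_min lexx.
  + by rewrite -(expRxMexpNx_1 K) ler_wpM2l ?expR_ge0// ge_min lexx orbT.
  + have := ler_norm M; rewrite /K; lra.
- apply/cvgeyPge => M; pose K := (`|M| + 1)%R.
  have K0 : (0 < K)%R by rewrite ltr_wpDl.
  have c0 : (0 < 2 * K + K ^+ 2)%R by rewrite addr_gt0 ?mulr_gt0// exprn_gt0.
  have a0 : (0 < Num.min 2^-1 (2 * K + K ^+ 2)^-1)%R by rewrite lt_min !invr_gt0 c0 ltr0n.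
  apply: filterS (sep _ a0) => n [A mA [muA nuA]].
  apply: lee_of_weighted mA muA nuA _ (ltW c0) _ _ _ (chi2_ge _ _ mA (ltW K0)).
  + by rewrite mulr_ge0// ltW.
  + by rewrite ge_min lexx.
  + by rewrite -[leRHS](mulfV (lt0r_neq0 c0)) ler_wpM2l ?(ltW c0)// ge_min lexx orbT.
  + have := ler_norm M; rewrite /K; lra.
Qed.

End separation_limits.

(** * Product measures and Gaussian moments *)

Section power_measure_integral.
Context d (T : measurableType d) {R : realType}.
Local Open Scope ereal_scope.

(** Tonelli's theorem for the first coordinate. *)
Lemma integral_power_measureS (mu : {sigma_finite_measure set T -> \bar R}) n
    (f : n.+1.-tuple T -> \bar R) : measurable_fun setT f -> (forall x, 0 <= f x) ->
  \int[power_measure mu n.+1]_x f x =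
  \int[mu]_z \int[power_measure mu n]_y f (cons_pair (z, y)).
Proof.
move=> mf f0.
rewrite [LHS](ge0_integral_pushforward (@measurable_cons_pair _ T n))//.
rewrite preimage_setT fubini_tonelli1//=.
by apply: measurableT_comp mf _; exact: measurable_cons_pair.
Qed.

End power_measure_integral.

Section coord_sum.
Context {R : realType}.
Local Open Scope ereal_scope.

Lemma measurable_coord_sum n : measurable_fun setT (@coord_sum R n).
Proof. by apply: measurable_sum => i; exact: measurable_tnth. Qed.

Lemma measurable_normr_coord_sum n :
  measurable_fun setT (fun x : Rn R n => `|coord_sum x|%R).
Proof. by apply: measurableT_comp => //; exact: measurable_coord_sum. Qed.

Lemma coord_sum_cons n (z : measurableTypeR R) (y : Rn R n) :
  coord_sum (cons_pair (z, y)) = (z + coord_sum y)%R.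
Proof.
rewrite /coord_sum big_ord_recl; congr (_ + _)%R.
by apply: eq_bigr => i _; rewrite tnthS.
Qed.

(** Completing the square: [exp (t x)] times the density of [N(0, s^2)] is
[exp (t^2 s^2 / 2)] times the density of [N(t s^2, s^2)]. *)
Lemma normal_prob_mgf (s t : R) : s != 0%R ->
  \int[normal_prob 0 s]_x (expR (t * x))%:E = (expR (t ^+ 2 * s ^+ 2 / 2))%:E.
Proof.
move=> s0.
rewrite (@integral_density _ _ _ (normal_prob 0 s) lebesgue_measure (normal_pdf 0 s))//; last 3 first.
- exact: measurable_normal_pdf.
- exact: normal_pdf_ge0.
- by apply/measurable_EFinP/measurableT_comp => //; exact: measurable_funM.
transitivity (\int[lebesgue_measure]_x
    ((expR (t ^+ 2 * s ^+ 2 / 2))%:E * (normal_pdf (t * s ^+ 2) s x)%:E)).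
  apply: eq_integral => x _; rewrite -!EFinM; congr EFin.
  rewrite !normal_pdfE// mulrCA [RHS]mulrCA; congr *%R.
  rewrite /normal_fun -!expRD; congr expR.
  by field.
rewrite ge0_integralZl ?lee_fin ?expR_ge0//; last 2 first.
- by apply/measurable_EFinP; exact: measurable_normal_pdf.
- by move=> x _; rewrite lee_fin normal_pdf_ge0.
by rewrite integral_normal_pdf mule1.
Qed.

Lemma gaussian_mgf n (s t : R) : s != 0%R ->
  \int[gaussian_Rn n s]_x (expR (t * coord_sum x))%:E =
  (expR (n%:R * (t ^+ 2 * s ^+ 2 / 2)))%:E.
Proof.
move=> s0; have mexp m : measurable_fun setT
    (fun x : Rn R m => (expR (t * coord_sum x))%:E).
  apply/measurable_EFinP/measurableT_comp => //; apply: measurable_funM => //.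
  exact: measurable_coord_sum.
elim: n => [|n IH].
  rewrite [LHS]integral_dirac; [|exact: measurableT|exact: mexp].
  transitivity (1 * (expR (t * coord_sum ([tuple] : Rn R 0)))%:E).
    by congr (_ * _); exact: diracT.
  rewrite mul1e /coord_sum big_ord0.
  by rewrite mulr0 mul0r.
rewrite [LHS]integral_power_measureS//.
under eq_integral => z _.
  under eq_integral => y _ do rewrite coord_sum_cons mulrDr expRD EFinM.
  rewrite ge0_integralZl//; last exact: mexp.
  over.
rewrite /= ge0_integralZr//; last 2 first.
- by apply/measurable_EFinP/measurableT_comp => //; exact: measurable_funM.
- by apply: integral_ge0 => x _; rewrite lee_fin expR_ge0.
rewrite IH normal_prob_mgf// -EFinM -expRD; congr (expR _)%:E.
by rewrite -natr1; ring.
Qed.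

End coord_sum.

Section gaussian_abs.
Context {R : realType}.
Local Open Scope ereal_scope.

Lemma normr_le_expR (x : R) : (`|x| <= expR x + expR (- x))%R.
Proof.
have h1 := expR_ge1Dx x; have h2 := expR_ge1Dx (- x).
have e1 := expR_gt0 x; have e2 := expR_gt0 (- x).
by rewrite ler_norml; apply/andP; split; lra.
Qed.

(** The variable is centred with variance [2 u], so its first absolute moment is
of order [sqrt u]. The bound comes from [|y| <= exp y + exp (- y)] applied to
[y = x / sqrt u], whose exponential moments do not depend on [u]; then
[2 sqrt u <= 1 + u]. *)
Lemma gaussian_abs_moment n (u : R) : (0 < n)%N -> (0 < u)%R ->
  \int[gaussian_Rn n (Num.sqrt u)]_x `|Num.sqrt (2 / n%:R) * coord_sum x|%:E <=
  (expR 1 * (1 + u))%:E.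
Proof.
move=> n0 u0; set s := Num.sqrt u; set c := Num.sqrt (2 / n%:R).
have s0 : (0 < s)%R by rewrite sqrtr_gt0.
have nR : (0 < n%:R :> R)%R by rewrite ltr0n.
have ss : (s ^+ 2 = u)%R by rewrite sqr_sqrtr// ltW.
have cc : (c ^+ 2 = 2 / n%:R)%R by rewrite sqr_sqrtr// divr_ge0// ltW.
have mexp t : measurable_fun setT
    (fun x : Rn R n => (expR (t * coord_sum x))%:E).
  apply/measurable_EFinP/measurableT_comp => //; apply: measurable_funM => //.
  exact: measurable_coord_sum.
pose t := (c / s)%R.
have mgf r : (r ^+ 2 = t ^+ 2)%R ->
    \int[gaussian_Rn n s]_x (expR (r * coord_sum x))%:E = (expR 1)%:E.
  move=> rt; rewrite gaussian_mgf ?lt0r_neq0// rt; congr (expR _)%:E.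
  by rewrite /t expr_div_n cc; field; rewrite !lt0r_neq0.
apply: (@le_trans _ _ (\int[gaussian_Rn n s]_x (s%:E *
    ((expR (t * coord_sum x))%:E + (expR (- t * coord_sum x))%:E)))).
  apply: ge0_le_integral => //.
  - apply/measurable_EFinP/measurableT_comp => //; apply: measurable_funM => //.
    exact: measurable_coord_sum.
  - by apply: emeasurable_funM => //; apply: emeasurable_funD; exact: mexp.
  - move=> x _; rewrite -EFinD -EFinM lee_fin mulNr.
    apply: le_trans (ler_wpM2l (ltW s0) (normr_le_expR _)).
    rewrite -{1}(ger0_norm (ltW s0)) -normrM mulrA.
    by rewrite /t mulrCA divff ?mulr1// lt0r_neq0.
rewrite ge0_integralZl ?lee_fin ?(ltW s0)//; last 2 first.
- by apply: emeasurable_funD; exact: mexp.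
- by move=> x _; rewrite adde_ge0// lee_fin expR_ge0.
rewrite ge0_integralD//.
rewrite !mgf ?sqrrN// -EFinD -EFinM lee_fin -ss.
have e1 := expR_gt0 (1 : R).
have : (s * 2 <= 1 + s ^+ 2)%R.
  by rewrite -subr_ge0 (_ : _ - _ = (s - 1) ^+ 2)%R ?sqr_ge0//; ring.
by rewrite -(ler_pM2l e1); lra.
Qed.

End gaussian_abs.

(** * The coordinate sum under the invariant law *)

Section translation.
Context {R : realType}.
Local Open Scope ereal_scope.

Lemma lebesgue_measure_translation (a : R) (A : set R) : measurable A ->
  pushforward lebesgue_measure ((fun x => x + a)%R : _ -> measurableTypeR R) A =
  lebesgue_measure A.
Proof.
move=> mA; apply/esym/lebesgue_measure_unique => //=.
  exact: measurable_funD.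
move=> _ _ [[b c]] _ <-.
rewrite /pushforward.
have -> : (fun x => x + a)%R @^-1` `]b, c] = `](b - a)%R, (c - a)%R]%classic.
  by apply/seteqP; split=> x /=; rewrite !in_itv/= ltrBlDr lerBrDr.
rewrite !lebesgue_measure_itv/= !lte_fin ltrD2r.
by case: ifP => // _; rewrite -!EFinB; congr EFin; ring.
Qed.

Lemma integral_translation (a : R) (f : R -> \bar R) :
  measurable_fun setT f -> (forall x, 0 <= f x) ->
  \int[lebesgue_measure]_x f (x + a)%R = \int[lebesgue_measure]_x f x.
Proof.
move=> mf f0.
have mD : measurable_fun setT ((fun x => x + a)%R : measurableTypeR R -> measurableTypeR R).
  exact: measurable_funD.
rewrite -[LHS](ge0_integral_pushforward mD lebesgue_measure measurableT mf)//.
by apply: eq_measure_integral => A mA _; exact: lebesgue_measure_translation.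
Qed.

(** Translation along the diagonal: it preserves the chamber and all the
differences of coordinates. *)
Definition translate n (a : R) (x : Rn R n) : Rn R n :=
  map_tuple (fun y => y + a)%R x.

Lemma translate_cons n a z (x : Rn R n) :
  translate a (cons_pair (z, x)) = cons_pair ((z + a)%R, translate a x).
Proof. exact/val_inj. Qed.

Lemma measurable_translate n a : measurable_fun setT (@translate n a).
Proof.
apply/measurable_fun_tnthP => i.
rewrite (_ : _ \o _ = fun x => tnth x i + a)%R; last first.
  by apply/funext => x /=; rewrite tnth_map.
by apply: measurable_funD => //; exact: measurable_tnth.
Qed.

Lemma integral_translate n (a : R) (f : Rn R n -> \bar R) :
  measurable_fun setT f -> (forall x, 0 <= f x) ->
  \int[lebesgue_Rn n]_x f (translate a x) = \int[lebesgue_Rn n]_x f x.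
Proof.
elim: n f => [|n IH] f mf f0.
  by apply: eq_integral => x _; rewrite (tuple0 x) (tuple0 (translate _ _)).
rewrite [LHS]integral_power_measureS//; last first.
  by apply: measurableT_comp mf _; exact: measurable_translate.
rewrite [RHS]integral_power_measureS//.
under eq_integral => z _.
  under eq_integral => y _ do rewrite translate_cons.
  rewrite (IH (fun y => f (cons_pair ((z + a)%R, y))))//; last first.
    apply: measurableT_comp mf _.
    by apply: measurableT_comp (@measurable_cons_pair _ _ n) _; exact: pair1_measurable.
  over.
apply: (integral_translation a
  (f := fun z => \int[lebesgue_Rn n]_x f (cons_pair (z, x)))); last first.
  by move=> z; exact: integral_ge0.
apply: (measurable_fun_fubini_tonelli_F (fun zx => f (cons_pair zx))) => //.
by apply: measurableT_comp mf _; exact: measurable_cons_pair.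
Qed.

End translation.

Section invariant_law_tail.
Context {R : realType}.
Implicit Types (beta K r : R) (n : nat).

Lemma closed_chamber_translate n a (x : Rn R n) :
  closed_chamber (translate a x) <-> closed_chamber x.
Proof.
by split=> h i j ij; have := h i j ij; rewrite !tnth_map lerD2r.
Qed.

(** The interaction is invariant under [translate], and the Gaussian factor picks
up the exponential of a multiple of [coord_sum]; this makes the law of
[coord_sum] under the invariant law explicit. *)
Lemma dou_weight_translate beta n a (x : Rn R n) :
  dou_weight beta (translate a x) =
  expR (- (n%:R * a * coord_sum x) - (n%:R * a) ^+ 2 / 2) * dou_weight beta x.
Proof.
rewrite /dou_weight mulrA -expRD; congr (expR _ * _).
  under eq_bigr do rewrite tnth_map sqrrD.
  rewrite !big_split/= sumr_const card_ord -mulr_suml -/(coord_sum x).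
  by rewrite -(mulr_natl (a ^+ 2)); field.
apply: eq_bigr => i _; apply: eq_bigr => j _.
by rewrite !tnth_map; congr (_ `^ _); ring.
Qed.

Lemma dou_weight_ge0 beta n (x : Rn R n) : 0 <= dou_weight beta x.
Proof.
by rewrite mulr_ge0 ?expR_ge0// prodr_ge0// => i _; rewrite prodr_ge0// => j _; exact: powR_ge0.
Qed.

Lemma measurable_dou_weight beta n : measurable_fun setT (@dou_weight R beta n).
Proof.
apply: measurable_funM.
  apply: measurableT_comp => //; apply: measurable_funM => //.
  by apply: measurable_sum => i; apply: measurable_funX; exact: measurable_tnth.
apply: measurable_prod => i _.
rewrite (_ : (fun _ => _) = fun x : Rn R n => \prod_(j < n)
    (if (j < i)%N then (tnth x i - tnth x j) `^ beta else 1)); last first.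
  by apply/funext => x; rewrite big_mkcond.
apply: measurable_prod => j _; case: (j < i)%N => //.
apply: (measurableT_comp (@measurable_powR R beta)).
by apply: measurable_funB; exact: measurable_tnth.
Qed.

Lemma measurable_closed_chamber n : measurable (@closed_chamber R n).
Proof.
rewrite (_ : @closed_chamber R n = \bigcap_(i in [set: 'I_n]) \bigcap_(j in [set: 'I_n])
    [set x : Rn R n | ((i <= j)%N ==> (tnth x i <= tnth x j)) = true]); last first.
  apply/seteqP; split=> x /= h.
    by move=> i _ j _ /=; apply/implyP => /h.
  by move=> i j ij; have /implyP := h i I j I; exact.
apply: fin_bigcap_measurable => // i _; apply: fin_bigcap_measurable => // j _.
case: (i <= j)%N => /=; last first.
  by rewrite (_ : [set _ | _] = setT)//; apply/seteqP; split.
exact: measurable_set_ler (measurable_tnth i) (measurable_tnth j).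
Qed.

Lemma measurable_coord_sum_ge n r K :
  measurable [set x : Rn R n | K <= r * coord_sum x].
Proof.
apply: (measurable_set_ler (f := cst K)) => //.
by apply: measurable_funM => //; exact: measurable_coord_sum.
Qed.

(** Chernoff bound, with [E exp (r * coord_sum) = exp (1 / 2)] for [r = 1] and
[r = - 1]. When [beta = 0] this is a Gaussian computation. Otherwise
[exp (r * coord_sum) * dou_weight] is [exp (1 / 2)] times a translate of
[dou_weight], so its integral over the chamber is [exp (1 / 2)] times that of the
weight, and the normalizing constant cancels. *)
Lemma invariant_law_exp_tail beta n (mu : probability (Rn R n) R) r K :
  (0 < n)%N -> dou_invariant_law beta mu -> r ^+ 2 = 1 ->
  (mu [set x | (K <= r * coord_sum x)%R] <= (expR (2^-1 - K))%:E)%E.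
Proof.
move=> n0 + r1; have nR : (n%:R : R) != 0 by rewrite pnatr_eq0 -lt0n.
set A := [set x | _]; have mA : measurable A by exact: measurable_coord_sum_ge.
have mexp : measurable_fun setT (fun x : Rn R n => expR (r * coord_sum x)).
  apply: measurableT_comp => //; apply: measurable_funM => //.
  exact: measurable_coord_sum.
rewrite /dou_invariant_law; case: ifP => [_ muE|_ [c c0 muE]].
  rewrite muE// -[leLHS]mul1e -integral_cst//.
  apply: (@le_trans _ _ (\int[gaussian_Rn n (Num.sqrt n%:R^-1)]_x
      ((expR (- K))%:E * (expR (r * coord_sum x))%:E))%E).
    rewrite integral_mkcond; apply: ge0_le_integral => //.
    - by move=> x _; rewrite patchE; case: ifP.
    - by apply/(measurable_restrictT _ _).1.
    - by apply/measurable_EFinP/measurable_funM.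
    - move=> x _; rewrite -EFinM -expRD patchE; case: ifPn => [|_]; last by rewrite lee_fin expR_ge0.
      rewrite inE /A /= => Kx; rewrite lee_fin (le_trans _ (expR_ge1Dx _))//.
      by rewrite lerDl addrC subr_ge0.
  rewrite ge0_integralZl//; last exact/measurable_EFinP.
  rewrite gaussian_mgf; last by rewrite sqrtr_eq0 -ltNge invr_gt0 ltr0n.
  rewrite -EFinM -expRD lee_fin ler_expR sqr_sqrtr ?invr_ge0// r1.
  by rewrite addrC lerD2r mul1r mulrA divff// mul1r.
pose f0 (x : Rn R n) := (dou_weight beta x * \1_(@closed_chamber R n) x)%R.
have f00 x : 0 <= f0 x by rewrite mulr_ge0// dou_weight_ge0.
have mf0 : measurable_fun setT f0.
  apply: measurable_funM; first exact: measurable_dou_weight.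
  by apply: measurable_indic; exact: measurable_closed_chamber.
have mG := @measurable_closed_chamber n.
(* The shift for which the factor of [dou_weight_translate] is
   [exp (r * coord_sum - 1 / 2)]. *)
pose a := - r / n%:R.
have f0a x : expR (2^-1 - K) * f0 (translate a x) = expR (r * coord_sum x - K) * f0 x.
  have na : n%:R * a = - r by rewrite /a mulrCA divff// mulr1.
  have -> : f0 (translate a x) = expR (r * coord_sum x - 2^-1) * f0 x.
    rewrite /f0 dou_weight_translate na sqrrN r1 mulNr opprK mul1r -mulrA.
    congr (_ * (_ * _)); rewrite !indicE; congr ((_ : bool)%:R).
    by apply/idP/idP; rewrite !inE => /closed_chamber_translate.
  by rewrite mulrA -expRD; congr (expR _ * _); ring.
have intE (B : set (Rn R n)) : measurable B ->
    (\int[lebesgue_Rn n]_(x in B `&` @closed_chamber R n) (dou_weight beta x)%:E =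
     \int[lebesgue_Rn n]_(x in B) (f0 x)%:E)%E.
  move=> mB; rewrite integral_mkcondr; apply: eq_integral => x _.
  by rewrite patchE /f0 indicE; case: ifPn => _; rewrite ?mulr1 ?mulr0.
rewrite muE// intE//.
have muT : (c%:E * \int[lebesgue_Rn n]_x (f0 x)%:E = 1)%E.
  by rewrite -intE// -muE//; exact: probability_setT.
rewrite -[leRHS]mule1 -muT muleCA lee_pmul2l//.
have mf0E : measurable_fun setT (EFin \o f0) by exact/measurable_EFinP.
have mf0a : measurable_fun setT (fun x : Rn R n => (f0 (translate a x))%:E).
  exact: measurableT_comp mf0E (@measurable_translate _ n a).
rewrite -(integral_translate a mf0E)// -ge0_integralZl ?lee_fin ?expR_ge0//; last first.
  by move=> x _; rewrite lee_fin.
rewrite [leLHS]integral_mkcond; apply: ge0_le_integral => //.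
- by move=> x _; rewrite patchE; case: ifP => // _; rewrite lee_fin.
- by apply/(measurable_restrictT _ _).1 => //; exact: measurable_funTS.
- exact: emeasurable_funM.
- move=> x _; rewrite -EFinM f0a patchE; case: ifPn => [|_]; last first.
    by rewrite lee_fin mulr_ge0// expR_ge0.
  rewrite inE /A /= => Kx; rewrite lee_fin ler_peMl//.
  by rewrite -expR0 ler_expR subr_ge0.
Qed.

Lemma invariant_law_tail beta n (mu : probability (Rn R n) R) K :
  (0 < n)%N -> dou_invariant_law beta mu ->
  (mu [set x | (K <= `|coord_sum x|)%R] <= (2 * expR (2^-1 - K))%:E)%E.
Proof.
move=> n0 hmu.
have -> : [set x : Rn R n | K <= `|coord_sum x|] =
    [set x | K <= 1 * coord_sum x] `|` [set x | K <= -1 * coord_sum x].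
  apply/seteqP; split=> x /=; rewrite ler_normr mul1r mulN1r.
    by move=> /orP.
  by move=> h; apply/orP.
apply: (le_trans (measureU2 _ _ _)); [exact: measurable_coord_sum_ge..|].
rewrite (_ : 2 * expR (2^-1 - K) = expR (2^-1 - K) + expR (2^-1 - K)); last by ring.
by rewrite EFinD; apply: leeD; apply: invariant_law_exp_tail hmu _; rewrite // expr2 ?mul1r ?mulrNN ?mulr1.
Qed.

End invariant_law_tail.

(** * The coordinate sum along a path *)

Section path.
Context {R : realType}.
Implicit Types (S Y : R -> R) (D : nat -> R) (h t : R).

(** The bound on the contribution of the noise to an implicit Euler scheme of
step [h]: with [q = (1 + h)^-1], this is
[q^k |D 0| + sum_(1 <= j <= k) q^(k + 1 - j) h |D j|], the discrete analogue of
[exp (- t) |D_0| + \int_0^t exp (- (t - s)) |D_s| ds]. *)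
Fixpoint euler_noise D h k : R :=
  match k with
  | 0 => `|D 0%N|
  | k'.+1 => (1 + h)^-1 * (euler_noise D h k' + h * `|D k|)
  end.

Lemma euler_noise_ge0 D h k : 0 <= h -> 0 <= euler_noise D h k.
Proof.
move=> h0; elim: k => [|k IH] //=.
by rewrite mulr_ge0 ?invr_ge0 ?addr_ge0// mulr_ge0.
Qed.

(** The increment of the noise between the [k]-th point of the grid and the final
time. Increments up to the final time are used because the equation for
[S s + (Y t - Y s)] contains no noise differential. *)
Definition gap Y t h k : R := Y t - Y (k%:R * h).

(** The quantity [V_k = S (k h) + gap k] satisfies
[V_(k+1) = q (V_k + h * gap (k+1) + error)] with [q = (1 + h)^-1], so the
distance from [V_k] to [q^k S 0] is at most [euler_noise k + del]: the constant
[del] is stable since [q (del + h del) = del]. At the final time the gap is 0,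
and [q^m >= exp (- m h)]. The implicit scheme is chosen for these two exact
estimates, which spare any limit of [q^m]. *)
Lemma implicit_euler S Y t h (del : R) (m : nat) : 0 < h -> 0 <= del ->
  t = m%:R * h ->
  (forall k, (k < m)%N -> `|S (k.+1%:R * h) - S (k%:R * h)
     - (Y (k.+1%:R * h) - Y (k%:R * h)) + h * S (k.+1%:R * h)| <= h * del) ->
  expR (- t) * `|S 0| - euler_noise (gap Y t h) h m - del <= `|S t|.
Proof.
move=> h0 del0 tm step; set q := (1 + h)^-1.
have h1 : 0 < 1 + h by rewrite addr_gt0.
have q0 : 0 < q by rewrite invr_gt0.
have main k : (k <= m)%N ->
    `|S (k%:R * h) + gap Y t h k - q ^+ k * S 0| <= euler_noise (gap Y t h) h k + del.
  elim: k => [_|k IH km].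
    by rewrite /= mul0r expr0 mul1r addrAC subrr add0r lerDl.
  have {}IH := IH (ltnW km); have := step _ km.
  set e := (X in `|X| <= h * del) => he.
  have -> : S (k.+1%:R * h) + gap Y t h k.+1 - q ^+ k.+1 * S 0 =
      q * ((S (k%:R * h) + gap Y t h k - q ^+ k * S 0) + h * gap Y t h k.+1 + e).
    apply: (mulfI (lt0r_neq0 h1)); rewrite mulrA divff ?mul1r; last exact: lt0r_neq0.
    rewrite exprS mulrBr !mulrA divff ?lt0r_neq0// mul1r /e /gap; ring.
  rewrite normrM (ger0_norm (ltW q0)) /=.
  have -> : q * (euler_noise (gap Y t h) h k + h * `|gap Y t h k.+1|) + del =
     q * (euler_noise (gap Y t h) h k + del + h * `|gap Y t h k.+1| + h * del).
    by rewrite /q; field; rewrite lt0r_neq0.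
  rewrite ler_wpM2l ?(ltW q0)//.
  apply: le_trans (ler_normD _ _) _; apply: lerD => //.
  apply: le_trans (ler_normD _ _) _; apply: lerD => //.
  by rewrite normrM (ger0_norm (ltW h0)).
have := main _ (leqnn m); rewrite /gap -tm subrr addr0 -/(gap Y t h) => hm.
have qe : expR (- t) <= q ^+ m.
  rewrite tm -mulrN expRM_natl lerXn2r ?nnegrE ?expR_ge0 ?(ltW q0)//.
  rewrite expRN lef_pV2 ?posrE ?expR_gt0//; exact: expR_ge1Dx.
have : q ^+ m * `|S 0| <= `|S t| + `|S t - q ^+ m * S 0|.
  have := ler_normD (S t) (q ^+ m * S 0 - S t).
  rewrite addrC subrK (distrC (q ^+ m * S 0)) normrM.
  by rewrite (ger0_norm (exprn_ge0 m (ltW q0))).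
have := ler_wpM2r (normr_ge0 (S 0)) qe; lra.
Qed.

Lemma uniform_continuity_itv S t (del : R) : 0 < del ->
  {within `[0, t], continuous S} ->
  exists2 eta : R, 0 < eta & forall s s', s \in `[0, t] -> s' \in `[0, t] ->
    `|s - s'| < eta -> `|S s - S s'| <= del.
Proof.
move=> del0 /subspace_continuousP cS.
have /compact_near_coveringP := @segment_compact R 0 t.
move=> /(_ R 0^'+ (fun eta s => s \in `[0, t] -> forall s', s' \in `[0, t] ->
    `|s - s'| < eta -> `|S s - S s'| <= del) _) cov.
have /cov : forall x, `[0, t]%classic x -> \forall x' \near x & eta \near 0^'+,
    x' \in `[0, t] -> forall s', s' \in `[0, t] ->
    `|x' - s'| < eta -> `|S x' - S s'| <= del.
  move=> x xt; have d2 : 0 < del / 2 by rewrite divr_gt0.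
  have /cvgrPdist_lt/(_ _ d2) := cS x xt.
  rewrite near_withinE => /nbhs_ballP[r /= r0 hr].
  have r2 : 0 < r / 2 by rewrite divr_gt0.
  exists (ball x (r / 2), [set eta : R | eta < r / 2]).
    split; [exact: nbhsx_ballx|exact: nbhs_right_lt].
  move=> [x' eta] /= [xx' er] x't s' s't x's'.
  have h1 : `|S x - S x'| < del / 2.
    by apply: hr => //=; apply: le_ball xx'; lra.
  have h2 : `|S x - S s'| < del / 2.
    apply: hr => //=; rewrite /ball/= in xx' *.
    rewrite -(subrKA x'); apply: le_lt_trans (ler_normD _ _) _; lra.
  rewrite -(subrKA (S x)); apply: le_trans (ler_normD _ _) _.
  rewrite (distrC (S x')); lra.
move=> near0.
near (0 : R)^'+ => eta; exists eta => // s s' st.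
have h : `[0, t]%classic `<=` (fun s => s \in `[0, t] -> forall s', s' \in `[0, t] ->
    `|s - s'| < eta -> `|S s - S s'| <= del) by near: eta.
exact: h.
Unshelve. all: by end_near. Qed.

End path.

Section langevin_path.
Context {R : realType}.
Notation leb := (@lebesgue_measure R).
Implicit Types (S Y : R -> R) (t : R).

Lemma integrable_itv S (a b : R) : 0 <= a -> {within `[0, +oo[, continuous S} ->
  leb.-integrable `[a, b] (EFin \o S).
Proof.
move=> a0 cS; apply: continuous_compact_integrable; first exact: segment_compact.
apply: continuous_subspaceW cS => x /=; rewrite !in_itv/= => /andP[ax _].
by rewrite (le_trans a0 ax).
Qed.

Lemma Rintegral_near_endpoint S (a b del : R) : 0 <= a -> a < b -> 0 <= del ->
  {within `[0, +oo[, continuous S} ->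
  (forall s, s \in `[a, b] -> `|S b - S s| <= del) ->
  `|(b - a) * S b - \int[leb]_(s in `[a, b]) S s| <= (b - a) * del.
Proof.
move=> a0 ab del0 cS hS.
have iS := integrable_itv b a0 cS.
have ba : fine (leb `[a, b]%classic) = b - a.
  by rewrite lebesgue_measure_itv/= lte_fin ab.
have cst_ab (r : R) : \int[leb]_(s in `[a, b]) r = (b - a) * r.
  by rewrite Rintegral_cst// ba mulrC.
have icst (r : R) : leb.-integrable `[a, b] (EFin \o cst r).
  apply: continuous_compact_integrable; first exact: segment_compact.
  by apply: continuous_subspaceT => x; exact: cvg_cst.
rewrite -cst_ab -RintegralB//; last exact: icst.
have iB : leb.-integrable `[a, b] (EFin \o (fun s => S b - S s)).
  exact: (integrableB _ (icst (S b)) iS).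
apply: le_trans (le_normr_Rintegral _ iB) _ => //.
rewrite -cst_ab; apply: le_Rintegral => //.
- exact: (integrable_norm iB).
- exact: icst.
Qed.

(** Uniform continuity of [S] on [0, t] makes the discretization error of
[implicit_euler] smaller than [del] for all fine enough grids. *)
Lemma langevin_lower_bound S Y t (del : R) : 0 < t -> 0 < del ->
  {within `[0, +oo[, continuous S} ->
  (forall s, 0 <= s -> S s = S 0 + Y s - \int[leb]_(r in `[0, s]) S r) ->
  \forall m \near \oo,
    expR (- t) * `|S 0| - euler_noise (gap Y t (t / m%:R)) (t / m%:R) m - del
    <= `|S t|.
Proof.
move=> t0 del0 cS SE.
have inc a b : 0 <= a -> a < b ->
    S b - S a = Y b - Y a - \int[leb]_(r in `[a, b]) S r.
  move=> a0 ab; have b0 := le_trans a0 (ltW ab).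
  have := @Rintegral_itvB R S (BLeft 0) (BRight b) a (integrable_itv b (lexx 0) cS).
  rewrite !bnd_simp => /(_ a0 (ltW ab)).
  have ioc := Rintegral_itv_obnd_cbnd (r := a) (b := BRight b) (f := S).
  rewrite ioc; last first.
    apply: integrableS (integrable_itv b a0 cS) => //.
    exact: subset_itv_oc_cc.
  by move=> <-; rewrite (SE b)// (SE a)//; ring.
have ct : {within `[0, t], continuous S}.
  apply: continuous_subspaceW cS => x /=.
  by rewrite !in_itv/= => /andP[-> _].
have [eta eta0 heta] := uniform_continuity_itv del0 ct.
near=> m.
have m0 : (0 < m)%N by near: m; exact: nbhs_infty_gt.
have mR : 0 < m%:R :> R by rewrite ltr0n.
have h0 : 0 < t / m%:R by rewrite divr_gt0.
have tm : t = m%:R * (t / m%:R) by rewrite mulrCA divff ?mulr1// gt_eqF.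
have heta' : t / m%:R < eta.
  rewrite ltr_pdivrMr// mulrC -ltr_pdivrMr//.
  by near: m; exact: nbhs_infty_gtr.
apply: implicit_euler => // [|k km]; first exact: ltW.
set h := t / m%:R in h0 tm heta' *.
have kh : 0 <= k%:R * h by rewrite mulr_ge0// ltW.
have khS : k.+1%:R * h = k%:R * h + h by rewrite -natr1 mulrDl mul1r.
have kt : k.+1%:R * h <= t by rewrite tm ler_wpM2r ?(ltW h0)// ler_nat.
have lt_kh : k%:R * h < k.+1%:R * h by rewrite khS ltrDl.
rewrite inc// addrC addrA addrAC [X in `|X|](_ : _ =
  h * S (k.+1%:R * h) - \int[leb]_(r in `[k%:R * h, k.+1%:R * h]) S r); last by ring.
have := Rintegral_near_endpoint kh lt_kh (ltW del0) cS.
have -> : k.+1%:R * h - k%:R * h = h by rewrite khS addrAC subrr add0r.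
apply => s; rewrite in_itv/= => /andP[ks sk]; apply: heta.
- by rewrite in_itv/= kt (le_trans kh (ltW lt_kh)).
- by rewrite in_itv/= (le_trans kh ks) (le_trans sk kt).
- by rewrite ger0_norm ?subr_ge0//; apply: le_lt_trans heta'; lra.
Unshelve. all: by end_near. Qed.

End langevin_path.

Section dou_path_sum.
Context {R : realType}.
Notation leb := (@lebesgue_measure R).

Lemma within_continuous_sum (A : set R) (I : Type) (s : seq I) (f : I -> R -> R) :
  (forall i, {within A, continuous (f i)}) ->
  {within A, continuous (fun r => \sum_(i <- s) f i r)}.
Proof.
move=> cf; elim: s => [|i s IH].
  under eq_fun do rewrite big_nil.
  by apply: continuous_subspaceT => x; exact: cvg_cst.
under eq_fun do rewrite big_cons.
by move=> x; apply: cvgD; [exact: cf|exact: IH].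
Qed.

Lemma sum_antisymmetric0 n (J : 'I_n -> 'I_n -> R) :
  (forall i j, j != i -> J i j = - J j i) ->
  \sum_(i < n) \sum_(j < n | j != i) J i j = 0.
Proof.
move=> anti; set A := LHS.
suff : A = - A by move=> AA; lra.
rewrite {1}/A (exchange_big_dep xpredT)//= -sumrN; apply: eq_bigr => j _.
rewrite -sumrN; apply: eq_big => [i|i ij]; first by rewrite eq_sym.
exact: anti.
Qed.

(** The interaction integrals are antisymmetric in [(i, j)] and cancel in the
sum, which leaves the equation of a scalar Ornstein-Uhlenbeck path. *)
Lemma dou_path_coord_sum beta n (x0 : Rn R n) (b x : R -> Rn R n) :
  dou_path beta x0 b x ->
  [/\ coord_sum (x 0) = coord_sum x0,
      {within `[0, +oo[, continuous (fun s => coord_sum (x s))}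
    & forall s, 0 <= s -> coord_sum (x s) =
        coord_sum (x 0) + Num.sqrt (2 / n%:R) * coord_sum (b s)
        - \int[leb]_(r in `[0, s]) coord_sum (x r)].
Proof.
move=> [x00 cx _ iJ xE]; split; first by rewrite x00.
  exact: within_continuous_sum.
move=> s s0; rewrite x00 /coord_sum Rintegral_sum//; last first.
  by move=> i; apply: integrable_itv => //; exact: cx.
under eq_bigr => i _ do rewrite xE//.
rewrite big_split/= sumrB big_split/= -mulr_sumr -mulr_sumr -[RHS]addr0.
congr (_ + _); have [->|b0] := eqVneq beta 0; first by rewrite !mul0r.
rewrite sum_antisymmetric0 ?mulr0// => i j ji.
rewrite -mulN1r -RintegralZl//; last by apply: iJ => //; rewrite eq_sym.
by apply: eq_Rintegral => r _; rewrite mulN1r -invrN opprB.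
Qed.

End dou_path_sum.

(** * The coordinate sum of the process *)

Section dou_tail.
Context {R : realType} d (Om : measurableType d) (P : probability Om R).

Lemma measurable_euler_noise (D : nat -> Om -> R) (h : R) (m : nat) :
  (forall k, measurable_fun setT (D k)) ->
  measurable_fun setT (fun w => euler_noise (D ^~ w) h m).
Proof.
move=> mD; elim: m => [|m IH] /=; first exact: measurableT_comp.
apply: measurable_funM => //; apply: measurable_funD => //.
by apply: measurable_funM => //; exact: measurableT_comp.
Qed.

(** The recursion of [euler_noise] preserves the bound
[C * (2 + (m - k) * h)]; at [k = m] it depends neither on the step nor on the
final time. *)
Lemma euler_noise_expectation (D : nat -> Om -> R) (C h : R) (m : nat) :
  0 <= h -> 0 <= C -> (forall k, measurable_fun setT (D k)) ->
  (forall k, (k <= m)%N ->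
    (\int[P]_w `|D k w|%:E <= (C * (1 + (m - k)%:R * h))%:E)%E) ->
  (\int[P]_w (euler_noise (D ^~ w) h m)%:E <= (2 * C)%:E)%E.
Proof.
move=> h0 C0 mD hD.
have h1 : 0 < 1 + h by lra.
have q0 : 0 <= (1 + h)^-1 by rewrite invr_ge0 ltW.
have mN k := measurable_euler_noise h k mD.
suff main k : (k <= m)%N ->
    (\int[P]_w (euler_noise (D ^~ w) h k)%:E <= (C * (2 + (m - k)%:R * h))%:E)%E.
  by apply: le_trans (main m (leqnn m)) _; rewrite subnn mul0r addr0 mulrC.
elim: k => [_|k IH km] /=.
  apply: le_trans (hD 0%N (leq0n _)) _; rewrite lee_fin ler_wpM2l//; lra.
under eq_integral do rewrite EFinM EFinD EFinM.
have mDk : measurable_fun setT (fun w => `|D k.+1 w|%:E).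
  by apply/measurable_EFinP/measurableT_comp.
rewrite ge0_integralZl ?lee_fin//; last 2 first.
- apply: emeasurable_funD; first exact/measurable_EFinP.
  exact: emeasurable_funM.
- by move=> w _; rewrite adde_ge0 ?mule_ge0 ?lee_fin// euler_noise_ge0.
rewrite ge0_integralD//; last 4 first.
- by move=> w _; rewrite lee_fin euler_noise_ge0.
- exact/measurable_EFinP.
- by move=> w _; rewrite mule_ge0.
- exact: emeasurable_funM.
rewrite ge0_integralZl//.
have b1 := IH (ltnW km); have b2 := hD _ km.
apply: (@le_trans _ _ ((1 + h)^-1%:E * ((C * (2 + (m - k)%:R * h))%:E +
   h%:E * (C * (1 + (m - k.+1)%:R * h))%:E))%E).
  by rewrite lee_wpmul2l// leeD// lee_wpmul2l.
rewrite -!(EFinM, EFinD) lee_fin -(subnSK km) -natr1.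
rewrite ler_pdivrMl//; lra.
Qed.

Variables (n : nat) (n0 : (0 < n)%N).
Implicit Types (F : R -> set (set Om)) (B : R -> Om -> Rn R n).

Lemma adapted_measurable F B t : filtration F -> adapted F B -> 0 <= t ->
  measurable_fun setT (B t).
Proof.
move=> [_ Fm _] BF t0 _ A mA; rewrite setTI; apply: (Fm t t0); exact: BF.
Qed.

(** The independence property, applied to the sure event, says that the increment
has law [N(0, (t - s) I_n)]; [gaussian_abs_moment] then applies. *)
Lemma brownian_increment_moment F B s t : filtration F -> brownian_motion P F B ->
  0 <= s -> s < t ->
  (\int[P]_w `|Num.sqrt (2 / n%:R) * coord_sum (B t w) -
              Num.sqrt (2 / n%:R) * coord_sum (B s w)|%:E
     <= (expR 1 * (1 + (t - s)))%:E)%E.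
Proof.
move=> hF [BF _ _ Binc] s0 st.
have ts0 : 0 < t - s by rewrite subr_gt0.
have mBs := adapted_measurable hF BF s0.
have mBt := adapted_measurable hF BF (le_trans s0 (ltW st)).
pose Del w : Rn R n := [tuple tnth (B t w) i - tnth (B s w) i | i < n].
have mDel : measurable_fun setT Del.
  apply/measurable_fun_tnthP => i.
  rewrite (_ : _ \o _ = fun w => tnth (B t w) i - tnth (B s w) i); last first.
    by apply/funext => w /=; rewrite tnth_mktuple.
  apply: measurable_funB.
    exact: measurableT_comp (measurable_tnth i) mBt.
  exact: measurableT_comp (measurable_tnth i) mBs.
have Dlaw A : measurable A -> pushforward P Del A = gaussian_Rn n (Num.sqrt (t - s)) A.
  move=> mA; have FT : F s setT.
    have [Fs _ _] := hF; have [F0 FC _] := Fs s s0.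
    by have := FC _ F0; rewrite setD0.
  have := Binc s t s0 st setT A FT mA.
  by rewrite setTI probability_setT mul1e.
pose f (x : Rn R n) := `|Num.sqrt (2 / n%:R) * coord_sum x|%:E.
have mf : measurable_fun setT f.
  apply/measurable_EFinP/measurableT_comp => //; apply: measurable_funM => //.
  exact: measurable_coord_sum.
apply: le_trans (gaussian_abs_moment n0 ts0).
have <- : (\int[P]_w f (Del w) = \int[gaussian_Rn n (Num.sqrt (t - s))]_x f x)%E.
  rewrite -[LHS](ge0_integral_pushforward mDel P measurableT mf).
    by apply: eq_measure_integral => A mA _; exact: Dlaw.
  by move=> x _; rewrite lee_fin.
rewrite le_eqVlt; apply/orP; left; apply/eqP; apply: eq_integral => w _.
rewrite /f /= -mulrBr /coord_sum -sumrB; congr (`|_ * _|%:E).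
by apply: eq_bigr => i _; rewrite tnth_mktuple.
Qed.

(** Markov's inequality for [euler_noise], whose expectation is at most
[2 * exp 1] for every grid. The term [- 1] absorbs the discretization error,
which is eventually smaller than 1 on almost every path but not uniformly
so. *)
Lemma dou_tail beta (x0 : Rn R n) (X : R -> {RV P >-> Rn R n}) t K :
  dou_process beta x0 X -> 0 < t -> 0 < K ->
  (P [set w | (`|coord_sum (X t w)| < expR (- t) * `|coord_sum x0| - K - 1)%R]
     <= (2 * expR 1 / K)%:E)%E.
Proof.
move=> [F [B [hF hB _ path]]] t0 K0; have [BF _ _ _] := hB.
pose Y w s := Num.sqrt (2 / n%:R) * coord_sum (B s w).
pose D m k w := gap (Y w) t (t / m%:R) k.
pose Z m w := euler_noise (D m ^~ w) (t / m%:R) m.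
have h0 m : 0 <= t / m%:R by rewrite divr_ge0// ltW.
have mY s : 0 <= s -> measurable_fun setT (Y ^~ s).
  move=> s0; apply: measurable_funM => //.
  apply: (measurableT_comp (@measurable_coord_sum R n)).
  exact: adapted_measurable hF BF s0.
have mD m k : measurable_fun setT (D m k).
  by apply: measurable_funB; apply: mY; [exact: ltW|rewrite mulr_ge0].
have mZ m : measurable_fun setT (Z m).
  exact: measurable_euler_noise.
have EZ m : (0 < m)%N -> (\int[P]_w (Z m w)%:E <= (2 * expR 1)%:E)%E.
  move=> m0; have mR : m%:R != 0 :> R by rewrite pnatr_eq0 -lt0n.
  apply: euler_noise_expectation (h0 m) (expR_ge0 1) (mD m) _ => k km.
  have tm : m%:R * (t / m%:R) = t by rewrite mulrCA divff ?mulr1.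
  have -> : (m - k)%:R * (t / m%:R) = t - k%:R * (t / m%:R).
    by rewrite natrB// mulrBl tm.
  move: km; rewrite leq_eqVlt => /predU1P[->|km].
    rewrite (eq_integral (cst 0%E)).
      by rewrite integral_cst// mul0e lee_fin mulr_ge0 ?expR_ge0// tm subrr addr0.
    by move=> w _; rewrite /D /gap tm subrr normr0.
  apply: brownian_increment_moment hF hB _ _; first by rewrite mulr_ge0.
  by rewrite -{2}tm ltr_pM2r ?ltr_nat// divr_gt0// ltr0n.
(* Index [m.+1], because a grid with zero steps has no moment bound. *)
apply: (probability_le_eventually (G := fun m => [set w | K <= Z m.+1 w])).
- rewrite (_ : [set _ | _] = ~` [set w | expR (- t) * `|coord_sum x0| - K - 1 <= `|coord_sum (X t w)|]).
    apply: measurableC; apply: (measurable_set_ler (f := cst _)) => //.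
    apply: measurableT_comp => //.
    exact: (measurableT_comp (@measurable_coord_sum R n)).
  by apply/seteqP; split=> w /=; rewrite ltNge => /negP.
- by move=> m; apply: (measurable_set_ler (f := cst _)).
- move=> m; have mG : measurable [set w | K <= Z m.+1 w].
    exact: (measurable_set_ler (f := cst _)).
  have PG : (P [set w | (K <= Z m.+1 w)%R] * K%:E <= (2 * expR 1)%:E)%E.
    rewrite muleC -integral_cst//; apply: le_trans (EZ m.+1 _) => //.
    apply: (@le_trans _ _ (\int[P]_(w in [set w | (K <= Z m.+1 w)%R]) (Z m.+1 w)%:E)%E).
      by apply: ge0_le_integral => //; [by move=> w _; rewrite lee_fin ltW|
        apply/measurable_EFinP; exact: measurable_funTS].
    apply: ge0_subset_integral => //; first exact/measurable_EFinP.
    by move=> w _; rewrite lee_fin euler_noise_ge0.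
  have PGfin : P [set w | K <= Z m.+1 w] \is a fin_num by exact: fin_num_measure.
  by move: PG; rewrite -(fineK PGfin) -EFinM !lee_fin ler_pdivlMr.
- apply: filterS path => w /dou_path_coord_sum[S0 cS SE] /= Xw.
  have [N _ hN] := langevin_lower_bound t0 ltr01 cS SE.
  exists N => // m /= Nm; have := hN m.+1 (leqW Nm).
  move=> /(le_lt_trans)/(_ Xw); rewrite S0 -/(Y w) /Z /D; lra.
Qed.

End dou_tail.

(** * Wasserstein distance and coordinate sums *)

Section wasserstein_bound.
Context {R : realType}.

(** Cauchy-Schwarz inequality, as nonnegativity of the variance of [v]. *)
Lemma sqr_coord_sum_le n (v : 'I_n -> R) :
  (\sum_(i < n) v i) ^+ 2 <= n%:R * \sum_(i < n) v i ^+ 2.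
Proof.
case: n v => [|n] v; first by rewrite !big_ord0 expr0n mul0r.
have nR : 0 < n.+1%:R :> R by rewrite ltr0n.
set s := \sum_i v i; set q := \sum_i v i ^+ 2.
have : 0 <= \sum_i (v i - s / n.+1%:R) ^+ 2 by apply: sumr_ge0 => i _; exact: sqr_ge0.
under eq_bigr do rewrite sqrrB.
rewrite big_split/= sumrB -/q sumr_const card_ord sumrMnl -mulr_suml -/s.
rewrite -(mulr_natr (_ ^+ 2) n.+1).
have -> : q - s * (s / n.+1%:R) *+ 2 + (s / n.+1%:R) ^+ 2 * n.+1%:R =
    (n.+1%:R * q - s ^+ 2) / n.+1%:R by field; rewrite gt_eqF.
by rewrite pmulr_lge0 ?invr_gt0// subr_ge0.
Qed.

(** For any coupling, with probability at least 1/2 the first coordinate sum is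
at least [r / 2] and the second less than [r / 4] in absolute value; by
[sqr_coord_sum_le] the cost is then at least [(r / 4)^2 / n]. *)
Lemma wasserstein_ge n (nu mu : probability (Rn R n) R) (r : R) : (0 < n)%N ->
  0 < r ->
  (nu [set x | (`|coord_sum x| < r / 2)%R] <= (4^-1)%:E)%E ->
  (mu [set x | (r / 4 <= `|coord_sum x|)%R] <= (4^-1)%:E)%E ->
  (sqrte (r ^+ 2 / (32 * n%:R))%:E <= wasserstein nu mu)%E.
Proof.
move=> n0 r0 hnu hmu; rewrite /wasserstein.
have nR : 0 < n%:R :> R by rewrite ltr0n.
have mabs := @measurable_normr_coord_sum R n.
set L := _ / _; have L0 : 0 <= L by rewrite divr_ge0 ?sqr_ge0// mulr_ge0.
set inf := ereal_inf _.
suff hinf : (L%:E <= inf)%E.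
  by rewrite lee_sqrt// (le_trans _ hinf)// lee_fin.
apply: le_ereal_inf_tmp => _ [g hg <-].
pose E1 : set (Rn R n) := [set x | (`|coord_sum x| < r / 2)%R].
pose E2 : set (Rn R n) := [set x | (r / 4 <= `|coord_sum x|)%R].
have mE1 : measurable E1 by exact: measurable_set_ltr.
have mE2 : measurable E2 by apply: (measurable_set_ler (f := cst _)).
have [g1 _] := hg _ mE1; have [_ g2] := hg _ mE2.
move: hnu hmu; rewrite -/E1 -/E2 -g1 -g2 => gE1 gE2.
have mF1 : measurable (fst @^-1` E1 : set (Rn R n * Rn R n)).
  by rewrite -[X in measurable X]setTI; exact: measurable_fst.
have mF2 : measurable (snd @^-1` E2 : set (Rn R n * Rn R n)).
  by rewrite -[X in measurable X]setTI; exact: measurable_snd.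
pose F := (fst @^-1` E1 `|` snd @^-1` E2 : set (Rn R n * Rn R n)).
have mF : measurable F by exact: measurableU.
have gF : (g F <= (2^-1)%:E)%E.
  apply: le_trans (measureU2 _ mF1 mF2) _.
  rewrite (_ : 2^-1 = 4^-1 + 4^-1 :> R); last by lra.
  by rewrite EFinD; apply: leeD; [exact: gE1|exact: gE2].
have mFC : measurable (~` F) by exact: measurableC.
have gFC : ((2^-1)%:E <= g (~` F))%E.
  rewrite probability_setC//; have gfin : g F \is a fin_num by exact: fin_num_measure.
  by move: gF; rewrite -(fineK gfin) -EFinB !lee_fin; lra.
have mcost : measurable_fun setT
    (fun z : Rn R n * Rn R n => \sum_(i < n) (tnth z.1 i - tnth z.2 i) ^+ 2).
  apply: measurable_sum => i; apply: measurable_funX; apply: measurable_funB.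
    exact: (measurableT_comp (measurable_tnth i) measurable_fst).
  exact: (measurableT_comp (measurable_tnth i) measurable_snd).
apply: (@le_trans _ _ ((2 * L)%:E * g (~` F))%E).
  apply: (@le_trans _ _ ((2 * L)%:E * (2^-1)%:E)%E).
    by rewrite -EFinM lee_fin mulrAC divff ?mul1r.
  by rewrite lee_wpmul2l// lee_fin mulr_ge0.
rewrite -integral_cst//.
apply: (@le_trans _ _ (\int[g]_(z in ~` F) (\sum_(i < n) (tnth z.1 i - tnth z.2 i) ^+ 2)%:E)%E).
  apply: ge0_le_integral => //.
  - by move=> z _; rewrite lee_fin mulr_ge0.
  - by apply/measurable_EFinP; exact: measurable_funTS.
  - move=> z /= nF; rewrite lee_fin.
    have h1 : r / 2 <= `|coord_sum z.1|.
      by rewrite leNgt; apply/negP => h; apply: nF; left.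
    have h2 : `|coord_sum z.2| < r / 4.
      by rewrite ltNge; apply/negP => h; apply: nF; right.
    have h3 : r / 4 <= `|coord_sum z.1 - coord_sum z.2|.
      by have := ler_normB (coord_sum z.1 - coord_sum z.2) (- coord_sum z.2); rewrite opprK subrK normrN; lra.
    have := sqr_coord_sum_le (fun i => tnth z.1 i - tnth z.2 i).
    rewrite sumrB -/(coord_sum z.1) -/(coord_sum z.2) => h4.
    have h5 : (r / 4) ^+ 2 <= (coord_sum z.1 - coord_sum z.2) ^+ 2.
      by rewrite -[leRHS]real_normK ?num_real// lerXn2r ?nnegrE// divr_ge0// ltW.
    have -> : 2 * L = (r / 4) ^+ 2 / n%:R by rewrite /L; field; rewrite gt_eqF.
    by rewrite ler_pdivrMr// [leRHS]mulrC; exact: le_trans h5 h4.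
apply: ge0_subset_integral => //; first exact/measurable_EFinP.
by move=> z _; rewrite lee_fin; apply: sumr_ge0 => i _; exact: sqr_ge0.
Qed.

End wasserstein_bound.

(** * Separation before the cutoff time *)

Section cutoff.
Context {R : realType}.

(** Positivity of [cutoff_time] excludes the values where [ln] is extended by
0. *)
Lemma mean_at_cutoff (D : distance) n (x0 : Rn R n) (eps : R) : (0 < n)%N ->
  0 < cutoff_time D x0 ->
  expR (- ((1 - eps) * cutoff_time D x0)) * `|coord_sum x0| =
  (if D is Wasserstein then Num.sqrt n%:R else 1) * expR (eps * cutoff_time D x0).
Proof.
move=> n0; have sn : 0 < Num.sqrt n%:R :> R by rewrite sqrtr_gt0 ltr0n.
have key (s y : R) : 0 < s -> 0 < ln (y / s) ->
    expR (- ((1 - eps) * ln (y / s))) * y = s * expR (eps * ln (y / s)).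
  move=> s0 ly; have ys : 0 < y / s.
    by rewrite ltNge; apply/negP => /ln0 ly0; rewrite ly0 ltxx in ly.
  have -> : eps * ln (y / s) = - ((1 - eps) * ln (y / s)) + ln (y / s) by ring.
  rewrite expRD lnK ?posrE// mulrCA; congr (_ * _).
  by rewrite mulrCA divff ?mulr1// gt_eqF.
case: D => /= hc; [| | | |exact: key];
  by have := key 1 `|coord_sum x0| ltr01; rewrite divr1; apply.
Qed.

(** [K = r / 4] in [dou_tail], where [r >= 4] gives [r - r / 4 - 1 >= r / 2]; the
exponential tail of the invariant law is weakened to [1 / r] so that both
bounds have the same form. *)
Lemma separation_tails d (Om : measurableType d) (P : probability Om R) beta n
    (x0 : Rn R n) (X : R -> {RV P >-> Rn R n}) (mu : probability (Rn R n) R)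
    (t r a : R) : (0 < n)%N -> dou_process beta x0 X -> dou_invariant_law beta mu ->
  0 < t -> r = expR (- t) * `|coord_sum x0| -> 4 <= r -> 8 * expR 1 / r <= a ->
  (distribution P (X t) [set x | (`|coord_sum x| < r / 2)%R] <= a%:E)%E /\
  (mu [set x | (r / 4 <= `|coord_sum x|)%R] <= a%:E)%E.
Proof.
move=> n0 hX hmu t0 rE r4 ra; have r0 : 0 < r by lra.
split.
  apply: le_trans (_ : (_ <= (2 * expR 1 / (r / 4))%:E)%E) _; last first.
    rewrite lee_fin; apply: le_trans ra; rewrite le_eqVlt; apply/orP; left.
    by apply/eqP; field; rewrite gt_eqF.
  apply: le_trans (dou_tail n0 hX t0 (K := r / 4) _); last by rewrite divr_gt0.
  rewrite -[leLHS]/(P [set w | (`|coord_sum (X t w)| < r / 2)%R]).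
  have mXt : measurable_fun setT (fun w => `|coord_sum (X t w)|).
    exact: (measurableT_comp (@measurable_normr_coord_sum R n)).
  apply: le_measure; rewrite ?inE; [exact: measurable_set_ltr..|].
  by move=> w /=; rewrite -rE; lra.
apply: le_trans (invariant_law_tail _ n0 hmu) _; rewrite lee_fin; apply: le_trans ra.
have -> : 2^-1 - r / 4 = - (r / 4 - 2^-1) by ring.
have e1 := expR_ge1Dx (1 : R).
have e2 := expR_ge1Dx (r / 4 - 2^-1).
rewrite expRN ler_pdivlMr// mulrAC ler_pdivrMr ?expR_gt0//.
nra.
Qed.

End cutoff.

Theorem corollary1p4 (R : realType) (beta : R) (hbeta : beta = 0 \/ 1 <= beta)
    (d : nat -> measure_display) (Om : forall n : nat, measurableType (d n))
    (P : forall n : nat, probability (Om n) R)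
    (x0 : forall n : nat, Rn R n)
    (hx0 : forall n : nat, (0 < n)%N -> state_space beta (x0 n))
    (X : forall n : nat, R -> {RV (P n) >-> Rn R n})
    (hX : forall n : nat, (0 < n)%N -> dou_process beta (x0 n) (X n))
    (Pinv : forall n : nat, probability (Rn R n) R)
    (hPinv : forall n : nat, (0 < n)%N -> dou_invariant_law beta (Pinv n))
    (D : distance)
    (hc : cutoff_time D (x0 n) @[n --> \oo] --> +oo)
    (eps : R) (heps0 : 0 < eps) (heps1 : eps < 1) :
  dist D (distribution (P n) (X n ((1 - eps) * cutoff_time D (x0 n)))) (Pinv n)
    @[n --> \oo] --> dist_max D.
Proof.
pose c n := cutoff_time D (x0 n); pose t n := (1 - eps) * c n.
pose r n := expR (- t n) * `|coord_sum (x0 n)|.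
pose G n := expR (eps * c n).
have growth M : \forall n \near \oo, [/\ (0 < n)%N, 0 < c n & M <= G n].
  near=> n; have n0 : (0 < n)%N by near: n; exact: nbhs_infty_gt.
  have cM : `|M| / eps + 1 <= c n by near: n; exact: (cvgryPge _).1 hc _.
  have M0 : 0 <= `|M| / eps by rewrite divr_ge0// ltW.
  split=> //; first by lra.
  have : `|M| <= eps * c n.
    by rewrite mulrC -ler_pdivrMr//; lra.
  have := ler_norm M; have := expR_ge1Dx (eps * c n); rewrite /G; lra.
have rE n : (0 < n)%N -> 0 < c n ->
    r n = (if D is Wasserstein then Num.sqrt n%:R else 1) * G n.
  exact: mean_at_cutoff.
have rG n : (0 < n)%N -> 0 < c n -> G n <= r n.
  move=> n0 c0; rewrite rE// ler_peMl ?expR_ge0//.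
  by case: D {c t r G growth rE c0 hc} => //; rewrite -[leLHS]sqrtr1 ler_wsqrtr// ler1n.
have tails a : 0 < a -> \forall n \near \oo,
    (0 < n)%N /\ 0 < c n /\ 0 < r n /\
    ((distribution (P n) (X n (t n)) [set x | (`|coord_sum x| < r n / 2)%R] <= a%:E)%E /\
     (Pinv n [set x | (r n / 4 <= `|coord_sum x|)%R] <= a%:E)%E).
  move=> a0; near=> n.
  have [n0 c0 G4] : [/\ (0 < n)%N, 0 < c n & Num.max 4 (8 * expR 1 / a) <= G n].
    by near: n; exact: growth.
  have := le_trans G4 (rG n n0 c0); rewrite ge_max => /andP[r4 ra].
  have rn0 : 0 < r n by lra.
  do 3 split => //.
  apply: (separation_tails n0 (hX n n0) (hPinv n n0) _ (erefl (r n)) r4).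
    by rewrite mulr_gt0// subr_gt0.
  by rewrite ler_pdivrMr// [leRHS]mulrC -ler_pdivrMr.
(* The Wasserstein distance needs the size of [r n], not only its divergence. *)
have [DW|DW] : D = Wasserstein \/ D <> Wasserstein by case: D {c t r G growth rE rG tails hc}; [right|right|right|right|left].
  subst D; apply/cvgeyPge => M.
  near=> n.
  have [n0 [c0 [r0 [hnu hmu]]]] : (0 < n)%N /\ 0 < c n /\ 0 < r n /\
    ((distribution (P n) (X n (t n)) [set x | (`|coord_sum x| < r n / 2)%R] <= (4^-1)%:E)%E /\
     (Pinv n [set x | (r n / 4 <= `|coord_sum x|)%R] <= (4^-1)%:E)%E).
    by near: n; apply: tails; rewrite invr_gt0.
  have [_ _ GM] : [/\ (0 < n)%N, 0 < c n & 6 * `|M| <= G n] by near: n; exact: growth.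
  apply: le_trans (wasserstein_ge n0 r0 hnu hmu).
  (* Here [r n ^ 2 / (32 n) = G n ^ 2 / 32], and [6 ^ 2 >= 32]. *)
  rewrite /= lee_fin (le_trans (ler_norm M))//.
  rewrite -[leLHS]ger0_norm// -sqrtr_sqr ler_wsqrtr//.
  have nR : 0 < n%:R :> R by rewrite ltr0n.
  rewrite rE// exprMn sqr_sqrtr ?(ltW nR)//.
  have -> : n%:R * G n ^+ 2 / (32 * n%:R) = G n ^+ 2 / 32 by field; rewrite gt_eqF.
  have := normr_ge0 M; move: (`|M|) (G n) GM => m g mG m0.
  have : 0 <= (g - 6 * m) * (g + 6 * m) by apply: mulr_ge0; lra.
  have := sqr_ge0 m; nra.
apply: dist_cvg_max DW _ => a a0.
apply: filterS (tails a a0) => n [n0 [c0 [r0 [hnu hmu]]]].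
exists [set x : Rn R n | r n / 2 <= `|coord_sum x|].
  by apply: (measurable_set_ler (f := cst _)) => //; exact: measurable_normr_coord_sum.
split.
  apply: le_trans hmu; apply: le_measure; rewrite ?inE.
  - by apply: (measurable_set_ler (f := cst _)) => //; exact: measurable_normr_coord_sum.
  - by apply: (measurable_set_ler (f := cst _)) => //; exact: measurable_normr_coord_sum.
  - by move=> x /=; lra.
rewrite (_ : ~` _ = [set x | `|coord_sum x| < r n / 2])//.
by apply/seteqP; split=> x /=; rewrite ltNge => /negP.
Unshelve. all: by end_near. Qed.
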